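(* Consider the linear time-invariant plant $x_{t+1}=Ax_t+B_uu_t+B_ww_t$, $t\ge 0$, with $A$ nonsingular, $(A,B_u)$ stabilizable, $Q\succeq 0$, $R\succ 0$ and $(A,Q)$ detectable, and the infinite-horizon stochastic LQR problem with $p\ge 0$ steps of disturbance preview $$J^*_{\infty,p}(i_0):=\min_{K\ \text{stabilizing}}\mathbb{E}\big[J_\infty(K,w,x_0)\mid i_0\big],\qquad J_\infty(K,w,x_0):=\lim_{T\to\infty}\frac1T\sum_{t=0}^{T-1}\big(x_t^\top Qx_t+u_t^\top Ru_t\big),$$ where the minimum is over stabilizing sequences of (possibly randomized) policies $K=\{K_0,K_1,\ldots\}$, with $K_t$ using the information $i_t=\{x_0,\ldots,x_t,w_0,\ldots,w_{t+p}\}$. Let $P\succeq 0$ be the stabilizing solution of the discrete-time algebraic Riccati equation $$0=P-A^\top PA-Q+A^\top PB_uH^{-1}B_u^\top PA,\qquad H:=R+B_u^\top PB_u,$$ and define the gains $$K_x:=H^{-1}B_u^\top PA,\qquad K_w:=H^{-1}B_u^\top PB_w,\qquad K_v:=H^{-1}B_u^\top .$$ Then the sequence of policies that achieves $J^*_{\infty,p}(i_0)$ is deterministic and has the form $$u_t^*=-K_xx_t-K_ww_t-K_vv_{t+1},$$ where $v_{t+1}$ depends on $\{w_{t+1},\ldots,w_{t+p}\}$ and is given by $$v_{t+1}=\sum_{j=t+1}^{t+p}\big[\hat A^\top\big]^{j-t}PB_ww_j,\qquad \hat A:=A-B_uK_x .$$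
   Context: Here $x_t\in\mathbb{R}^{n_x}$, $u_t\in\mathbb{R}^{n_u}$, $w_t\in\mathbb{R}^{n_w}$ are the state, input and disturbance, and the real matrices $A,B_u,B_w,Q,R$ have compatible dimensions, with $Q,R$ symmetric. The disturbance is independent and identically distributed (IID) noise with $\mathbb{E}[w_i]=0$ and $\mathbb{E}[w_iw_j^\top]=\delta_{ij}I$ for all $i,j\ge 0$. The initial condition $x_0$ may be non-zero. The integer $p\ge 0$ is the preview length. A policy at time $t$ is a conditional probability density over actions given the information, $K_t(u_t,i_t):=\mathrm{Prob}(u_t\mid i_t)$; deterministic policies $u_t=k_t(i_t)$ are a special case. A sequence of policies is stabilizing if the resulting state remains uniformly bounded (in $t$) in both mean and second moment. Under the stated assumptions the Riccati equation has a unique stabilizing solution $P\succeq 0$, i.e. a solution for which $H\succ 0$ and $\hat A=A-B_uK_x$ is a Schur matrix (spectral radius $<1$). *)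

(* Defs.v *)
From HB Require Import structures.
From mathcomp Require Import all_boot all_order all_algebra.
From mathcomp Require Import complex.
From mathcomp Require Import all_classical all_reals all_analysis measurable_realfun.

Set Implicit Arguments.
Unset Strict Implicit.
Unset Printing Implicit Defensive.
Import Order.TTheory GRing.Theory Num.Theory.
Import numFieldNormedType.Exports.

Local Open Scope classical_set_scope.
Local Open Scope ring_scope.

(* Matrices carry the product sigma-algebra, i.e. the one generated by the
   entries; over a realType this is the Borel sigma-algebra of R^(m * n). *)
Definition measure_matrix_display : measure_display -> measure_display.
Proof. exact. Qed.

Section matrix_measurable.
Context {d : measure_display} {T : sigmaRingType d} (m n : nat).

Definition matrix_measurable : set (set 'M[T]_(m, n)) :=
  <<s \bigcup_(ij in [set: 'I_m * 'I_n])
        preimage_set_system setT (fun M : 'M[T]_(m, n) => M ij.1 ij.2)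
          measurable >>.

Let matrix_measurable0 : matrix_measurable set0.
Proof. exact: sigma_algebra0. Qed.

Let matrix_measurableC A : matrix_measurable A -> matrix_measurable (~` A).
Proof. exact: sigma_algebraC. Qed.

Let matrix_measurable_bigcup (F : (set 'M[T]_(m, n))^nat) :
  (forall i, matrix_measurable (F i)) -> matrix_measurable (\bigcup_i F i).
Proof. exact: sigma_algebra_bigcup. Qed.

HB.instance Definition _ := @isMeasurable.Build (measure_matrix_display d)
  'M[T]_(m, n) matrix_measurable matrix_measurable0 matrix_measurableC
  matrix_measurable_bigcup.

End matrix_measurable.

Section matrix_conditions.
Context {R : realType}.

Definition quad n (M : 'M[R]_n) (x : 'cV[R]_n) : R := (x^T *m M *m x) 0 0.

Definition psd n (M : 'M[R]_n) : Prop := M^T = M /\ forall x, 0 <= quad M x.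

Definition pd n (M : 'M[R]_n) : Prop :=
  M^T = M /\ forall x, x != 0 -> 0 < quad M x.

Definition schur n (M : 'M[R]_n) : Prop :=
  forall z : R[i], eigenvalue (map_mx (real_complex R) M) z -> `|z| < 1.

Definition stabilizable n m (A : 'M[R]_n) (B : 'M[R]_(n, m)) : Prop :=
  exists F : 'M[R]_(m, n), schur (A - B *m F).

Definition detectable n m (A : 'M[R]_n) (C : 'M[R]_(m, n)) : Prop :=
  exists L : 'M[R]_(n, m), schur (A - L *m C).

End matrix_conditions.

Section riccati.
Context {R : realType} (nx nu nw : nat).
Variables (A : 'M[R]_nx) (Bu : 'M[R]_(nx, nu)) (Bw : 'M[R]_(nx, nw)).
Variables (Q : 'M[R]_nx) (Ru : 'M[R]_nu) (P : 'M[R]_nx).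

Definition riccati_H : 'M[R]_nu := Ru + Bu^T *m P *m Bu.

Definition gain_x : 'M[R]_(nu, nx) := invmx riccati_H *m Bu^T *m P *m A.

Definition gain_w : 'M[R]_(nu, nw) := invmx riccati_H *m Bu^T *m P *m Bw.

Definition gain_v : 'M[R]_(nu, nx) := invmx riccati_H *m Bu^T.

Definition closed_loop_matrix : 'M[R]_nx := A - Bu *m gain_x.

Definition riccati_equation : Prop :=
  0 = P - A^T *m P *m A - Q
      + A^T *m P *m Bu *m invmx riccati_H *m Bu^T *m P *m A.

Definition stabilizing_solution : Prop :=
  [/\ psd P, riccati_equation, pd riccati_H & schur closed_loop_matrix].

End riccati.

(* The values of i_t = {x_0, ..., x_t, w_0, ..., w_(t+p)}. *)
Notation info R nx nw p t :=
  ((t.+1).-tuple 'cV[R]_nx * ((t + p).+1).-tuple 'cV[R]_nw)%type.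

Definition policy_sequence (R : realType) (nx nu nw p : nat) : Type :=
  forall t : nat, R.-pker (info R nx nw p t) ~> 'cV[R]_nu.

Section preview_feedback.
Context {R : realType} (nx nu nw : nat).
Variables (A : 'M[R]_nx) (Bu : 'M[R]_(nx, nu)) (Bw : 'M[R]_(nx, nw)).
Variables (Ru : 'M[R]_nu) (P : 'M[R]_nx) (p t : nat).

Definition preview_term (i : info R nx nw p t) : 'cV[R]_nx :=
  \sum_(t.+1 <= j < (t + p).+1)
    ((closed_loop_matrix A Bu Ru P)^T ^+ (j - t)) *m P *m Bw *m nth 0 i.2 j.

Definition preview_feedback (i : info R nx nw p t) : 'cV[R]_nu :=
  - (gain_x A Bu Ru P *m nth 0 i.1 t)
  - gain_w Bu Bw Ru P *m nth 0 i.2 t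
  - gain_v Bu Ru P *m preview_term i.

End preview_feedback.

Section probability_notions.
Context {d : measure_display} {Omega : measurableType d} {R : realType}.
Variable Pr : probability Omega R.

Definition mutually_independent (I : choiceType) (G : I -> set (set Omega)) :
    Prop :=
  forall (s : seq I) (E : I -> set Omega), uniq s ->
    (forall i, i \in s -> G i (E i)) ->
    Pr (\bigcap_(i in [set` s]) E i) = (\prod_(i <- s) Pr (E i))%E.

(* v is a version of z |-> E[J | Z = z]; it is only used for J >= 0, where both
   integrals make sense even if J is not integrable. *)
Definition is_cond_expectation d' (T : measurableType d') (Z : Omega -> T)
    (J : Omega -> \bar R) (v : T -> \bar R) : Prop :=
  measurable_fun setT v /\
  forall B : set T, measurable B ->
    (\int[Pr]_(omega in Z @^-1` B) J omega
     = \int[Pr]_(omega in Z @^-1` B) v (Z omega))%E.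

End probability_notions.

Section stochastic_lqr.
Context {d : measure_display} {Omega : measurableType d} {R : realType}.
Variable Pr : probability Omega R.
Context (nx nu nw : nat).
Variables (A : 'M[R]_nx) (Bu : 'M[R]_(nx, nu)) (Bw : 'M[R]_(nx, nw)).
Variables (Q : 'M[R]_nx) (Ru : 'M[R]_nu) (p : nat).
Variables (x0 : Omega -> 'cV[R]_nx) (w : nat -> Omega -> 'cV[R]_nw).

Definition sigma_of d' (T : measurableType d') (X : Omega -> T) :
    set (set Omega) :=
  preimage_set_system setT X measurable.

Definition second_moment n (X : Omega -> 'cV[R]_n) : \bar R :=
  'E_Pr[fun omega => ((X omega)^T *m X omega) 0%R 0%R]%E.

(* A deterministic initial state is the case of a constant x0. *)
Record initial_state : Prop := {
  initial_measurable : measurable_fun setT x0;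
  initial_second_moment : (second_moment x0 < +oo)%E }.

(* The family indexed by option nat is x0 (None) together with the w_t
   (Some t): the noise is independent, and independent of the initial state. *)
Record iid_noise : Prop := {
  noise_measurable : forall t, measurable_fun setT (w t);
  noise_independent : mutually_independent Pr
    (fun o : option nat => if o is Some t then sigma_of (w t) else sigma_of x0);
  noise_identically_distributed : forall (s t : nat) (B : set 'cV[R]_nw),
    measurable B -> Pr (w s @^-1` B) = Pr (w t @^-1` B);
  noise_mean : forall t a, ('E_Pr[fun omega => w t omega a 0%R] = 0)%E;
  noise_covariance : forall s t a b,
    ('E_Pr[fun omega => (w s omega a 0 * w t omega b 0)%R]
     = ((s == t) && (a == b))%:R%:E)%E }.

Definition information (x : nat -> Omega -> 'cV[R]_nx) (t : nat)
    (omega : Omega) : info R nx nw p t :=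
  ([tuple x s omega | s < t.+1], [tuple w s omega | s < (t + p).+1]).

(* i_0 does not depend on the policy since the state at time 0 is x0. *)
Definition initial_information : Omega -> info R nx nw p 0%N :=
  information (fun=> x0) 0%N.

Definition history (u : nat -> Omega -> 'cV[R]_nu) (t : nat) :
    set (set Omega) :=
  <<s sigma_of x0 `|` \bigcup_s sigma_of (w s)
      `|` \bigcup_(s in [set s | (s < t)%N]) sigma_of (u s) >>.

(* (x, u) is a trajectory of the plant under the policies K. The last field says
   that the conditional law of u_t is K_t(., i_t), given not only i_t but also
   the earlier inputs and the whole disturbance: u_t depends on those only
   through i_t. *)
Record closed_loop (K : policy_sequence R nx nu nw p)
    (x : nat -> Omega -> 'cV[R]_nx) (u : nat -> Omega -> 'cV[R]_nu) : Prop := {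
  loop_initial : x 0%N = x0;
  loop_dynamics : forall t omega,
    x t.+1 omega = A *m x t omega + Bu *m u t omega + Bw *m w t omega;
  loop_input_measurable : forall t, measurable_fun setT (u t);
  loop_input_law : forall t (E : set Omega) (B : set 'cV[R]_nu),
    history u t E -> measurable B ->
    (Pr (E `&` u t @^-1` B)
     = \int[Pr]_(omega in E) K t (information x t omega) B)%E }.

Definition stabilizing (x : nat -> Omega -> 'cV[R]_nx) : Prop :=
  exists M : R, forall t,
    (forall a, `|'E_Pr[fun omega => x t omega a 0%R]| <= M%:E)%E
    /\ (second_moment (x t) <= M%:E)%E.

Definition average_cost (x : nat -> Omega -> 'cV[R]_nx)
    (u : nat -> Omega -> 'cV[R]_nu) (T : nat) (omega : Omega) : R :=
  T%:R^-1 * \sum_(0 <= t < T) (quad Q (x t omega) + quad Ru (u t omega)).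

(* The almost sure limit of the average costs when it exists; the limsup gives a
   value in [0, +oo] to the stabilizing policies for which it does not. *)
Definition cost_infty (x : nat -> Omega -> 'cV[R]_nx)
    (u : nat -> Omega -> 'cV[R]_nu) (omega : Omega) : \bar R :=
  limn_esup (fun T => (average_cost x u T omega)%:E).

(* V is the optimal cost i_0 |-> min_K E[J | i_0], attained by the trajectory
   (x, u). *)
Definition attains_min_cost (x : nat -> Omega -> 'cV[R]_nx)
    (u : nat -> Omega -> 'cV[R]_nu) (V : info R nx nw p 0%N -> \bar R) : Prop :=
  is_cond_expectation Pr initial_information (cost_infty x u) V /\
  forall K' x' u' V', closed_loop K' x' u' -> stabilizing x' ->
    is_cond_expectation Pr initial_information (cost_infty x' u') V' ->
    {ae Pr, forall omega,
      (V (initial_information omega) <= V' (initial_information omega))%E}.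

Definition optimal (K : policy_sequence R nx nu nw p) : Prop :=
  (exists x u, closed_loop K x u) /\
  forall x u, closed_loop K x u ->
    [/\ stabilizing x,
        {ae Pr, forall omega, cvgn (fun T => average_cost x u T omega)}
      & exists V, attains_min_cost x u V].

End stochastic_lqr.

(* Main.v *)
(* Put v_t = sum_(j < p) (Ahat^T)^(j+1) P Bw w_(t+j).  By the Riccati equation,
   completing the square gives, along every trajectory,
     sum_(t < T) (x_t' Q x_t + u_t' R u_t)
       = L_0 - L_T + sum_(t < T) (u_t - u*_t)' H (u_t - u*_t)
         + sum_(t < T) phi(w_t, ..., w_(t+p))
         + 2 sum_(t < T) x_t' (Ahat^T)^(p+1) P Bw w_(t+p),
   where L_t = x_t' P x_t + 2 x_t' v_t and phi is a fixed quadratic form.  The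
   phi-terms have a constant almost sure Cesaro limit c: products of noises at
   distinct times are martingale differences, those at equal times obey
   Kolmogorov's law.  In the last sum w_(t+p) is independent of x_t, even under
   randomized policies, so its Cesaro means vanish.  When E|x_T|^2 is bounded,
   L_T / T tends to 0 along T = 2^k, so the limsup of the average costs is at
   least c almost surely, for every stabilizing policy.  With u = u* the state
   follows a stable linear system driven by the noise; then L_T / T tends to 0
   along all T, and the average costs converge to c. *)
Require Import Defs.
From HB Require Import structures.
From mathcomp Require Import all_boot all_order all_algebra.
From mathcomp Require Import complex ring lra.
From mathcomp Require Import all_classical all_reals all_analysis measurable_realfun.
Import Order.TTheory GRing.Theory Num.Theory.
Import numFieldNormedType.Exports.
Set Implicit Arguments.
Unset Strict Implicit.
Unset Printing Implicit Defensive.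
Local Open Scope classical_set_scope.
Local Open Scope ring_scope.

(** * Powers of Schur matrices *)

(** The optimal conditional cost turns out to be the constant [c]. An almost sure lower bound and an
    almost sure limit therefore settle both halves of [attains_min_cost]: no Bellman recursion is
    solved, no conditional expectation is constructed, and [c] is never computed. What shapes the
    proof is the scarcity of moments. The noise has two, and a competing state has a bounded second
    moment only, so squares of products cannot be handled by fourth moments. For factors at
    different times independence splits the second moment of the product, and an L^2 martingale
    argument works. For factors at the same time the products are merely integrable, which calls for
    truncation. Likewise [E|x_T|^2 / T] is only known to be of order [1 / T], not summable over all
    [T]; it is summable over powers of 2, and the limsup in [cost_infty] makes these enough for a
    lower bound. *)

Lemma geometric_recurrence_bound (C : numFieldType) (l : C) (rho r D : C)
    (y z : nat -> C) :
  `|l| <= rho -> 0 <= rho -> rho < r -> 0 <= D ->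
  (forall k, y k.+1 = l * y k + z k) -> (forall k, `|z k| <= D * r ^+ k) ->
  exists2 D', 0 <= D' & forall k, `|y k| <= D' * r ^+ k.
Proof.
move=> lrho rho0 rhor D0 yE zD.
have r0 : 0 <= r by rewrite (le_trans rho0) ?ltW.
have rr : 0 < r - rho by rewrite subr_gt0.
(* A constant [D'] above the initial modulus with [D <= D' * (r - rho)] is preserved by the
   recurrence: the gap between the two rates absorbs the forcing. *)
exists (`|y 0%N| + D / (r - rho)).
  by rewrite addr_ge0// divr_ge0// ltW.
elim=> [|k IH]; first by rewrite expr0 mulr1 lerDl divr_ge0 // ltW.
rewrite yE (le_trans (ler_normD _ _))// normrM.
set D' := _ + _ in IH *.
apply: (@le_trans _ _ (rho * (D' * r ^+ k) + D * r ^+ k)).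
  by apply: lerD => //; apply: ler_pM.
rewrite mulrA -mulrDl exprS mulrA ler_wpM2r ?exprn_ge0//.
rewrite -lerBrDl -(mulrC r) -mulrBl mulrDr mulrCA divff ?gt_eqF// mulr1.
by rewrite lerDr mulr_ge0// ltW.
Qed.

(** Each eigenvalue has modulus below 1, but a decay rate needs one bound for all of them: the
    characteristic polynomial has finitely many roots, so the largest modulus works. [complex.Re]
    brings the modulus, a complex number here, back to [R]. *)
Lemma schur_uniform {R : realType} n (M : 'M[R]_n) : schur M ->
  exists2 rho : R, 0 <= rho < 1 &
    forall z : R[i], eigenvalue (map_mx (real_complex R) M) z -> `|z| <= rho%:C%C.
Proof.
move=> sM; set Mc := map_mx _ M in sM *.
have [rs rsE] := closed_field_poly_normal (char_poly Mc).
rewrite (eqP (char_poly_monic _)) scale1r in rsE.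
have rs1 z : z \in rs -> complex.Re `|z| < 1.
  move=> zrs; have /sM : eigenvalue Mc z.
    by rewrite eigenvalue_root_char rsE root_prod_XsubC.
  by rewrite ltcE => /andP[_ zlt1]; exact: zlt1.
exists (\big[Order.max/0]_(z <- rs) complex.Re `|z|).
  apply/andP; split; first exact: bigmax_ge_id.
  rewrite big_seq; elim/big_ind: _ => [|x y x1 y1|z]; rewrite ?ltr01 //; last exact: rs1.
  by rewrite gt_max x1.
move=> z; rewrite eigenvalue_root_char rsE root_prod_XsubC => zrs.
have -> : `|z| = (complex.Re `|z|)%:C%C by rewrite RRe_real// normr_real.
by rewrite lecR; apply: (@le_bigmax_seq _ _ _ rs 0 z xpredT (fun u => complex.Re `|u|)).
Qed.

(* Cayley-Hamilton factors the characteristic polynomial into shifts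
   [S - l_i], each of which is inverted on geometrically decaying sequences. *)
Lemma schur_power_bound {R : realType} n (M : 'M[R]_n) : schur M ->
  exists D r : R, [/\ 0 <= D, 0 <= r < 1 &
    forall k a b, `|(M ^+ k) a b| <= D * r ^+ k].
Proof.
case: n M => [|n] M; first by exists 0, 0; split=> // [|k []]//; rewrite lexx ltr01.
move=> /schur_uniform[rho /andP[rho0 rho1]]; set Mc := map_mx _ M => Mrho.
(* The rate must exceed [rho], since powers at a multiple eigenvalue may carry polynomial factors,
   and still stay below 1. *)
pose r := (rho + 1) / 2.
have rhor : rho < r by rewrite /r; lra.
have r01 : 0 <= r < 1 by rewrite /r; apply/andP; split; lra.
have [rs rsE] := closed_field_poly_normal (char_poly Mc).
rewrite (eqP (char_poly_monic _)) scale1r in rsE.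
have rsrho z : z \in rs -> `|z| <= rho%:C%C.
  by move=> zrs; apply: Mrho; rewrite eigenvalue_root_char rsE root_prod_XsubC.
have ch : horner_mx Mc (\prod_(z <- rs) ('X - z%:P)) = 0.
  by rewrite -rsE; exact: Cayley_Hamilton.
have key : forall a b, exists2 D : R[i], 0 <= D &
    forall k, `|(Mc ^+ k) a b| <= D * (r%:C%C) ^+ k.
  move=> a b; pose N s := horner_mx Mc (\prod_(z <- s) ('X - z%:P)).
  have : exists2 D : R[i], 0 <= D & forall k, `|(Mc ^+ k *m N rs) a b| <= D * (r%:C%C) ^+ k.
    by exists 0 => // k; rewrite /N ch mulmx0 mxE normr0 mul0r.
  (* The factors are removed one at a time, from the full product, which is zero, down to the empty
     one, which leaves [Mc ^+ k] itself. *)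
  elim: rs rsrho {rsE ch} => [|z s IH] szrho.
    by move=> [D D0 HD]; exists D => // k; have := HD k; rewrite /N big_nil rmorph1 mulmx1.
  move=> [D D0 HD]; apply: IH => [u us|]; first by apply: szrho; rewrite in_cons us orbT.
  pose y k := (Mc ^+ k *m N s) a b.
  pose w k := (Mc ^+ k *m N (z :: s)) a b.
  apply: (@geometric_recurrence_bound _ z (rho%:C%C) (r%:C%C) D y w) => //.
  - by apply: szrho; rewrite mem_head.
  - by rewrite ler0c.
  - by rewrite ltcR.
  move=> k.
  have wE : Mc ^+ k *m N (z :: s) = Mc ^+ k.+1 *m N s - z *: (Mc ^+ k *m N s).
    rewrite /N big_cons rmorphM /= rmorphB /= horner_mx_X horner_mx_C.
    rewrite -!mulmxE mulmxBl mulmxBr mul_scalar_mx mulmxA -scalemxAr.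
    by rewrite exprSr -mulmxE.
  have subE (X Y : 'M[R[i]]_n.+1) : (X - z *: Y) a b = X a b - z * Y a b by rewrite !mxE.
  rewrite /w wE subE /y.
  by rewrite addrC subrK.
have /choice[D HD] : forall ab : 'I_n.+1 * 'I_n.+1, exists D : R, 0 <= D /\
    forall k, `|(M ^+ k) ab.1 ab.2| <= D * r ^+ k.
  move=> [a b]; have [D D0 HD] := key a b; exists (complex.Re D).
  have DE : D = (complex.Re D)%:C%C by rewrite RRe_real// ger0_real.
  split; first by move: D0; rewrite {1}DE ler0c.
  move=> k /=; have := HD k.
  rewrite -(rmorphXn (map_mx (real_complex R))) mxE DE -rmorphXn -rmorphM /=.
  by rewrite normc_def /= expr0n /= addr0 sqrtr_sqr lecR.
have D0 ab : 0 <= D ab by case: (HD ab).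
exists (\sum_ab D ab), r; split=> //; first exact: sumr_ge0.
move=> k a b; have [_ /(_ k)/= /le_trans] := HD (a, b); apply.
have /andP[r0 _] := r01.
rewrite ler_wpM2r ?exprn_ge0//.
by rewrite (bigD1 (a, b))//= lerDl sumr_ge0.
Qed.

(** * Energies of stable linear systems *)

Lemma normr_mul_le {R : realFieldType} (x y : R) :
  `|x| * `|y| <= (x ^+ 2 + y ^+ 2) / 2.
Proof.
rewrite -(real_normK (num_real x)) -(real_normK (num_real y)).
by move: `|x| `|y| => a b; have := sqr_ge0 (a - b); nra.
Qed.

Lemma sqrrD_le {R : realFieldType} (x y : R) :
  (x + y) ^+ 2 <= 2 * (x ^+ 2 + y ^+ 2).
Proof. by have := sqr_ge0 (x - y); nra. Qed.

Section dot_product.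
Context {R : realType}.

Definition dot n (x y : 'cV[R]_n) : R := (x^T *m y) 0 0.

Lemma dotE n (x y : 'cV[R]_n) : dot x y = \sum_a x a 0 * y a 0.
Proof. by rewrite /dot mxE; apply: eq_bigr => a _; rewrite mxE. Qed.

Lemma dotC n (x y : 'cV[R]_n) : dot x y = dot y x.
Proof. by rewrite !dotE; apply: eq_bigr => a _; rewrite mulrC. Qed.

Lemma dotDl n (x y z : 'cV[R]_n) : dot (x + y) z = dot x z + dot y z.
Proof. by rewrite /dot linearD mulmxDl mxE. Qed.

Lemma dotDr n (x y z : 'cV[R]_n) : dot z (x + y) = dot z x + dot z y.
Proof. by rewrite dotC dotDl !(dotC z). Qed.

Lemma dotNl n (x y : 'cV[R]_n) : dot (- x) y = - dot x y.
Proof. by rewrite /dot linearN mulNmx mxE. Qed.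

Lemma dotNr n (x y : 'cV[R]_n) : dot x (- y) = - dot x y.
Proof. by rewrite dotC dotNl dotC. Qed.

Lemma dot_mull m n (M : 'M[R]_(m, n)) x y : dot (M *m x) y = dot x (M^T *m y).
Proof. by rewrite /dot trmx_mul mulmxA. Qed.

Lemma quad_dot n (M : 'M[R]_n) x : quad M x = dot x (M *m x).
Proof. by rewrite /quad /dot mulmxA. Qed.

Lemma dot_sqr n (x : 'cV[R]_n) : dot x x = \sum_a x a 0 ^+ 2.
Proof. by rewrite dotE; apply: eq_bigr => a _; rewrite expr2. Qed.

Lemma dot_ge0 n (x : 'cV[R]_n) : 0 <= dot x x.
Proof. by rewrite dot_sqr sumr_ge0 // => a _; rewrite sqr_ge0. Qed.

Lemma sqr_le_dot n (x : 'cV[R]_n) a : x a 0 ^+ 2 <= dot x x.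
Proof.
by rewrite dot_sqr (bigD1 a)//= lerDl sumr_ge0// => b _; rewrite sqr_ge0.
Qed.

Lemma normr_dot_le n (x y : 'cV[R]_n) : `|dot x y| <= dot x x + dot y y.
Proof.
rewrite dotE !dot_sqr -big_split (le_trans (ler_norm_sum _ _ _))//.
apply: ler_sum => a _ /=; rewrite normrM (le_trans (normr_mul_le _ _))//.
by rewrite ler_pdivrMr// ler_peMr ?addr_ge0 ?sqr_ge0// ler1n.
Qed.

Lemma dot_mulmx_le m n (M : 'M[R]_(m, n)) : exists2 C : R, 0 <= C &
  forall x, dot (M *m x) (M *m x) <= C * dot x x.
Proof.
pose c := \sum_i \sum_j `|(M^T *m M) i j|.
have c0 : 0 <= c by apply: sumr_ge0 => i _; exact: sumr_ge0.
exists c => // x.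
rewrite dot_mull mulmxA dotE mulr_suml; apply: ler_sum => i _.
rewrite mxE mulr_sumr mulr_suml; apply: ler_sum => j _.
apply: (le_trans (ler_norm _)); rewrite mulrCA normrM ler_wpM2l//.
rewrite normrM.
apply: (le_trans (normr_mul_le _ _)).
by rewrite ler_pdivrMr// mulr_natr mulr2n lerD ?sqr_le_dot.
Qed.

Lemma dotD_le n (x y : 'cV[R]_n) : dot (x + y) (x + y) <= 2 * (dot x x + dot y y).
Proof.
rewrite !dot_sqr -big_split mulr_sumr /=; apply: ler_sum => a _.
by rewrite mxE sqrrD_le.
Qed.

Lemma pd_unitmx n (M : 'M[R]_n) : pd M -> M \in unitmx.
Proof.
move=> [_ Mpd]; apply/contraT; rewrite -row_free_unit -kermx_eq0.
move=> /rowV0Pn[v /sub_kermxP vM0 v0].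
have [vT0|/Mpd] := eqVneq v^T 0; first by rewrite -(trmxK v) vT0 trmx0 eqxx in v0.
by rewrite /quad trmxK vM0 mul0mx mxE ltxx.
Qed.

Lemma pd_quad_ge0 n (M : 'M[R]_n) : pd M -> forall x, 0 <= quad M x.
Proof.
move=> [_ Mpd] x; have [->|/Mpd/ltW//] := eqVneq x 0.
by rewrite quad_dot mulmx0 /dot mulmx0 mxE.
Qed.

End dot_product.

(* The energy of the state of a stable linear system driven by inputs of
   energies [e t], up to a multiplicative constant. *)
Fixpoint leaky_sum {R : pzRingType} (r q0 : R) (e : nat -> R) (t : nat) : R :=
  if t is s.+1 then r * leaky_sum r q0 e s + e s else q0.

Lemma leaky_sum_ge0 {R : numDomainType} (r q0 : R) e t :
  0 <= r -> 0 <= q0 -> (forall s, 0 <= e s) -> 0 <= leaky_sum r q0 e t.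
Proof.
by move=> r0 q00 e0; elim: t => //= t IH; rewrite addr_ge0// mulr_ge0.
Qed.

(** Used with [eps] arbitrarily small and [c] depending on it: this is how sublinear forcing
    produces a sublinear energy. *)
Lemma leaky_sum_linear_growth {R : realFieldType} (r q0 eps c : R) e t :
  0 <= r < 1 -> 0 <= q0 -> 0 <= eps -> 0 <= c ->
  (forall s, e s <= eps * s%:R + c) ->
  leaky_sum r q0 e t <= q0 + (eps * t%:R + c) / (1 - r).
Proof.
move=> /andP[r0 r1] q00 eps0 c0 ele.
have r1' : 0 < 1 - r by rewrite subr_gt0.
elim: t => [|t IH] /=.
  by rewrite mulr0 add0r lerDl divr_ge0// ltW.
have := ele t; set E := eps * t%:R + c in IH * => et.
have E0 : 0 <= E by rewrite /E addr_ge0// mulr_ge0.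
apply: (@le_trans _ _ (r * (q0 + E / (1 - r)) + E)).
  by apply: lerD => //; rewrite ler_wpM2l.
have -> : r * (q0 + E / (1 - r)) + E = r * q0 + E / (1 - r).
  by field; lra.
rewrite lerD//; first by rewrite ler_piMl// ltW.
rewrite ler_pM2r ?invr_gt0// /E lerD2r ler_wpM2l//.
by rewrite ler_nat.
Qed.

Section stable_system.
Context {R : realType}.

Let n1 n (x : 'cV[R]_n) : R := \sum_a `|x a 0|.

Let n1_ge0 n (x : 'cV[R]_n) : 0 <= n1 x.
Proof. exact: sumr_ge0. Qed.

Let n1_sqr_le n (x : 'cV[R]_n) : n1 x ^+ 2 <= n%:R * dot x x.
Proof.
rewrite expr2 [X in X * _]/n1 mulr_suml.
under eq_bigr do rewrite mulr_sumr.
rewrite dot_sqr mulr_natl.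
pose S : R := \sum_(i < n) \sum_(j < n) (x i 0 ^+ 2 + x j 0 ^+ 2) / 2.
apply: (@le_trans _ _ S).
  apply: ler_sum => i _; apply: ler_sum => j _.
  exact: normr_mul_le.
rewrite /S; under eq_bigr do rewrite -mulr_suml big_split /= sumr_const card_ord.
rewrite -mulr_suml big_split /= sumr_const card_ord sumrMnl.
by rewrite -mulr2n -[X in X / _]mulr_natr mulfK// pnatr_eq0.
Qed.

(** [C] and [r] depend on [M] alone, so the estimate applies pathwise to a random trajectory. It is
    proved for the sum of absolute values, which is subadditive along the recursion, and squared
    only at the end, where convexity keeps the rate [r]. *)
Lemma schur_energy n (M : 'M[R]_n) : schur M ->
  exists C r : R, [/\ 0 <= C, 0 <= r < 1 &
    forall x eta : nat -> 'cV[R]_n,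
      (forall t, x t.+1 = M *m x t + eta t) -> forall t,
      dot (x t) (x t) <=
        C * leaky_sum r (dot (x 0%N) (x 0%N)) (fun t => dot (eta t) (eta t)) t].
Proof.
move=> /schur_power_bound[D [r [D0 r01 MD]]]; have /andP[r0 r1] := r01.
have r1' : 0 < 1 - r by rewrite subr_gt0.
pose K : R := n%:R * D.
have K0 : 0 <= K by rewrite mulr_ge0.
have n1M k x : n1 (M ^+ k *m x) <= K * r ^+ k * n1 x.
  apply: (@le_trans _ _ (\sum_(a < n) D * r ^+ k * n1 x)); last first.
    by rewrite sumr_const card_ord -mulr_natl !mulrA.
  apply: ler_sum => a _; rewrite mxE (le_trans (ler_norm_sum _ _ _))//.
  by rewrite /n1 mulr_sumr; apply: ler_sum => b _; rewrite normrM ler_wpM2r.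
(* [K ^+ 2] comes from the power bound in [n1], [n%:R] from comparing [n1 ^+ 2] with [dot], and the
   inverse of [1 - r] from convexity. *)
exists (K ^+ 2 * (n%:R / (1 - r))), r; split=> //.
  by rewrite mulr_ge0 ?sqr_ge0// divr_ge0// ltW.
move=> x eta xE t.
pose a := leaky_sum r (n1 (x 0%N)) (fun t => n1 (eta t)).
have a0 s : 0 <= a s by apply: leaky_sum_ge0.
(* All powers [k] are carried along, since one step of the recursion turns [M ^+ k] into
   [M ^+ k.+1]. *)
have xa k : n1 (M ^+ k *m x t) <= K * r ^+ k * a t.
  elim: t k => [|t IH] k; first exact: n1M.
  rewrite xE mulmxDr [M ^+ k *m (M *m _)]mulmxA -[M ^+ k *m M]/(M ^+ k * M).
  rewrite -exprSr /= mulrDr mulrA -(mulrA K) -exprSr.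
  apply: le_trans (lerD (IH _) (n1M _ _)).
  by rewrite -big_split; apply: ler_sum => b _; rewrite mxE ler_normD.
have := xa 0%N; rewrite expr0 mul1mx mulr1 => {}xa.
have dot_n1 : dot (x t) (x t) <= n1 (x t) ^+ 2.
  rewrite dot_sqr expr2 [X in _ <= X * _]/n1 mulr_suml; apply: ler_sum => b _.
  rewrite -(real_normK (num_real (x t b 0))) expr2 ler_wpM2l//.
  by rewrite /n1 (bigD1 b)//= lerDl sumr_ge0.
apply: (le_trans dot_n1); apply: (@le_trans _ _ ((K * a t) ^+ 2)).
  by rewrite ler_sqr ?nnegrE ?mulr_ge0.
rewrite exprMn -mulrA ler_wpM2l ?sqr_ge0// {xa dot_n1}.
have nr : n%:R <= n%:R / (1 - r) :> R.
  by rewrite ler_pdivlMr// ler_piMr// lerBlDr lerDl.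
elim: t => [|t IH] /=.
  by rewrite (le_trans (n1_sqr_le _))// ler_wpM2r ?dot_ge0.
(* convexity: [(r a + (1 - r) b) ^ 2 <= r a ^ 2 + (1 - r) b ^ 2] with
   [b = n1 (eta t) / (1 - r)] *)
apply: (@le_trans _ _ (r * a t ^+ 2 + n1 (eta t) ^+ 2 / (1 - r))).
  rewrite -/(a t); set b := n1 _.
  have -> : r * a t ^+ 2 + b ^+ 2 / (1 - r) =
    (r * a t + b) ^+ 2 + r * (1 - r) * (a t - b / (1 - r)) ^+ 2.
    by field; lra.
  by rewrite lerDl mulr_ge0 ?sqr_ge0// mulr_ge0// ltW.
rewrite [X in _ <= X]mulrDr lerD//.
  by rewrite [X in _ <= X]mulrCA ler_wpM2l.
by rewrite [X in _ <= X]mulrAC ler_wpM2r ?invr_ge0 ?n1_sqr_le// ltW.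
Qed.

End stable_system.

(** * Completion of squares *)

Section completion_of_squares.
Context {R : realType} (nx nu : nat).
Variables (A : 'M[R]_nx) (Bu : 'M[R]_(nx, nu)).
Variables (Q : 'M[R]_nx) (Ru : 'M[R]_nu) (P : 'M[R]_nx).
Hypothesis P_solution : stabilizing_solution A Bu Q Ru P.

Let H := riccati_H Bu Ru P.

Let P_sym : P^T = P. Proof. by case: P_solution => -[]. Qed.

Let H_sym : H^T = H. Proof. by case: P_solution => _ _ []. Qed.

Let H_unit : H \in unitmx. Proof. by apply: pd_unitmx; case: P_solution. Qed.

(** The minimiser over [u] of [quad Ru u + quad P x' + 2 * dot x' g], where
    [x' = A *m x + Bu *m u + d]: [d] is the known disturbance and [g] gives the linear part of the
    cost-to-go. *)
Definition optimal_input (x d g : 'cV[R]_nx) : 'cV[R]_nu :=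
  - (gain_x A Bu Ru P *m x) - invmx H *m (Bu^T *m (P *m d + g)).

(** The value of that same minimum at [x = 0]: what the disturbance costs whatever the state and the
    input. *)
Definition forcing_cost (d g : 'cV[R]_nx) : R :=
  dot d (P *m d) + 2 * dot d g
  - dot (Bu^T *m (P *m d + g)) (invmx H *m (Bu^T *m (P *m d + g))).

Let dot_sym n (M : 'M[R]_n) x y : M^T = M -> dot x (M *m y) = dot y (M *m x).
Proof. by move=> Msym; rewrite dotC dot_mull Msym. Qed.

(** One step of dynamic programming, kept as an identity instead of a minimum: it holds for every
    input, with the distance to the minimiser as a square. The linear part of the value moves
    backwards in time by the transposed closed-loop matrix. *)
Lemma stage_cost_completion (x d g : 'cV[R]_nx) (u : 'cV[R]_nu) :
  let x' := A *m x + Bu *m u + d in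
  let L y z := quad P y + 2 * dot y z in
  quad Q x + quad Ru u =
    L x ((closed_loop_matrix A Bu Ru P)^T *m (P *m d + g)) - L x' g
    + quad H (u - optimal_input x d g) + forcing_cost d g.
Proof.
move=> x' L.
have [_ PE _ _] := P_solution.
have Hi_sym : (invmx H)^T = invmx H by rewrite trmx_inv H_sym.
have [f fE] : {f | f = A *m x + d} by eexists.
pose Hi := invmx H.
pose b1 := Bu^T *m (P *m (A *m x)); pose b0 := Bu^T *m (P *m d + g).
(* Twice [b] is the gradient of the stage objective at [u = 0], split into the part [b1] of the
   state and the part [b0] of the disturbance; the sigma-type keeps [b] opaque. *)
have [b bE] : {b | b = b1 + b0} by eexists.
have Kx : gain_x A Bu Ru P *m x = Hi *m b1 by rewrite /gain_x /b1 !mulmxA.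
have uE : optimal_input x d g = - (Hi *m b).
  by rewrite /optimal_input Kx -/b0 bE mulmxDr opprD.
have QE : quad Q x = quad P x - quad P (A *m x) + dot b1 (Hi *m b1).
  have QM : Q = P - A^T *m P *m A + A^T *m P *m Bu *m Hi *m Bu^T *m P *m A.
    have := PE; rewrite /riccati_equation => /eqP.
    rewrite eq_sym addrAC subr_eq0 => /eqP <-.
    by [].
  rewrite {1}QM !quad_dot !mulmxDl mulNmx dotDr dotDr dotNr; congr (_ - _ + _).
    by rewrite dot_mull !mulmxA.
  rewrite /b1 dot_mull trmxK dot_mull P_sym dot_mull !mulmxA.
  by rewrite /Hi.
have step1 : quad Ru u + L x' g =
    quad H u + 2 * dot u b + quad P f + 2 * dot f g.
  rewrite /L /x' addrAC -fE !quad_dot /H /riccati_H mulmxDl dotDr.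
  rewrite mulmxDr !dotDl !dotDr (dot_sym (Bu *m u) f P_sym).
  have -> : dot u (Bu^T *m P *m Bu *m u) = dot (Bu *m u) (P *m (Bu *m u)).
    by rewrite dot_mull !mulmxA.
  have -> : dot u b = dot f (P *m (Bu *m u)) + dot (Bu *m u) g.
    rewrite (dot_sym f _ P_sym) [dot (Bu *m u) g]dot_mull dot_mull -dotDr.
    by rewrite bE /b1 /b0 fE !mulmxDr addrA.
  ring.
have step2 : quad H u + 2 * dot u b =
    quad H (u - optimal_input x d g) - dot b (Hi *m b).
  have HHi : H *m (Hi *m b) = b by rewrite mulmxA mulmxV// mul1mx.
  rewrite uE opprK !quad_dot mulmxDr HHi !dotDl !dotDr [dot (Hi *m b) b]dotC.
  rewrite (dot_sym (Hi *m b) u H_sym) HHi.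
  ring.
have LxE : 2 * dot x ((closed_loop_matrix A Bu Ru P)^T *m (P *m d + g)) =
   2 * dot (A *m x) (P *m d + g) - 2 * dot b1 (Hi *m b0).
  rewrite -dot_mull /closed_loop_matrix mulmxBl dotDl dotNl -mulmxA Kx.
  rewrite [dot (Bu *m _) _]dot_mull -/b0 [in RHS](dot_sym b1 b0 Hi_sym).
  by rewrite [dot (Hi *m b1) _]dotC mulrBr.
rewrite {1}/L LxE.
have -> : L x' g = quad H u + 2 * dot u b + quad P f + 2 * dot f g - quad Ru u.
  by rewrite -step1 addrAC subrr add0r.
rewrite step2 QE /forcing_cost -/b0 -/Hi fE !quad_dot bE !mulmxDr.
rewrite !dotDl !dotDr !(dot_sym b0 b1 Hi_sym) (dot_sym d (A *m x) P_sym).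
ring.
Qed.

Context (nw : nat).
Variables (Bw : 'M[R]_(nx, nw)) (p : nat).

Definition preview_gain (j : nat) : 'M[R]_(nx, nw) :=
  (closed_loop_matrix A Bu Ru P)^T ^+ j *m P *m Bw.

Definition preview_sum (xi : nat -> 'cV[R]_nw) (t : nat) : 'cV[R]_nx :=
  \sum_(j < p) preview_gain j.+1 *m xi (t + j)%N.

(** With infinite preview the recursion would close exactly on [v_t]. Keeping [p] terms leaves over
    the contribution of [w_(t+p)], one place beyond the window of [v_t]. *)
Lemma preview_sum_recursion xi t :
  (closed_loop_matrix A Bu Ru P)^T *m (P *m (Bw *m xi t) + preview_sum xi t.+1) =
  preview_sum xi t + preview_gain p.+1 *m xi (t + p)%N.
Proof.
rewrite /preview_sum -(@big_ord_recr _ _ _ _ (fun j => preview_gain j.+1 *m xi (t + j)%N)).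
rewrite big_ord_recl mulmxDr; congr (_ + _).
  by rewrite /preview_gain expr1 addn0 !mulmxA.
rewrite mulmx_sumr; apply: eq_bigr => j _.
by rewrite addSnnS /preview_gain [in RHS]exprS !mulmxA.
Qed.

Lemma cost_completion (x : nat -> 'cV[R]_nx) (u : nat -> 'cV[R]_nu) xi T :
  (forall t, x t.+1 = A *m x t + Bu *m u t + Bw *m xi t) ->
  let L t := quad P (x t) + 2 * dot (x t) (preview_sum xi t) in
  let ustar t := optimal_input (x t) (Bw *m xi t) (preview_sum xi t.+1) in
  \sum_(0 <= t < T) (quad Q (x t) + quad Ru (u t)) =
    L 0%N - L T + \sum_(0 <= t < T) quad H (u t - ustar t)
    + \sum_(0 <= t < T) (forcing_cost (Bw *m xi t) (preview_sum xi t.+1)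
        + 2 * dot (x t) (preview_gain p.+1 *m xi (t + p)%N)).
Proof.
move=> xE L ustar.
have -> : L 0%N - L T = \sum_(0 <= t < T) (L t - L t.+1).
  by rewrite -[RHS]opprK -sumrN; under eq_bigr do rewrite opprB; rewrite telescope_sumr// opprB.
rewrite -!big_split /=; apply: eq_bigr => t _.
rewrite (stage_cost_completion _ (Bw *m xi t) (preview_sum xi t.+1)) -xE.
rewrite preview_sum_recursion dotDr /ustar /L.
ring.
Qed.

End completion_of_squares.

(** * Square-integrable random variables *)

Section square_integrable.
Context {d : measure_display} {Omega : measurableType d} {R : realType}.
Variable Pr : probability Omega R.

Let L1 (f : Omega -> R) := Pr.-integrable setT (EFin \o f).

Definition sq_integrable (f : Omega -> R) : Prop :=
  measurable_fun setT f /\ Pr.-integrable setT (EFin \o (fun x => f x ^+ 2)).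

Lemma integrable_le (f g : Omega -> R) : measurable_fun setT f ->
  L1 g -> (forall x, `|f x| <= g x) -> L1 f.
Proof.
move=> mf ig fg; apply: (le_integrable _ _ _ ig) => //.
  exact/measurable_EFinP.
by move=> x _ /=; rewrite lee_fin (le_trans (fg x))// ler_norm.
Qed.

Lemma integrable_addr (f g : Omega -> R) : L1 f -> L1 g ->
  L1 (fun x => f x + g x).
Proof. by move=> iF ig; have := integrableD measurableT iF ig. Qed.

Lemma integrable_mulrl (k : R) (f : Omega -> R) : L1 f -> L1 (fun x => k * f x).
Proof. by move=> iF; have := integrableZl measurableT k iF. Qed.

Lemma integrable_sumr (I : Type) (s : seq I) (f : I -> Omega -> R) :
  (forall i, L1 (f i)) -> L1 (fun x => \sum_(i <- s) f i x).
Proof.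
move=> iF; elim: s => [|i s IH].
  under eq_fun do rewrite big_nil; exact: integrable0.
under eq_fun do rewrite big_cons; exact: integrable_addr.
Qed.

Lemma integrable_cst_prob (c : R) : L1 (fun=> c).
Proof. exact: finite_measure_integrable_cst. Qed.

Lemma sq_integrable_integrableM (f g : Omega -> R) :
  sq_integrable f -> sq_integrable g -> L1 (fun x => f x * g x).
Proof.
move=> [mf if2] [mg ig2]; have ifg2 := integrable_addr if2 ig2.
apply: (integrable_le _ ifg2) => [|x]; first exact: measurable_funM.
rewrite normrM (le_trans (normr_mul_le _ _))//.
by rewrite ler_pdivrMr// ler_peMr ?addr_ge0 ?sqr_ge0// ler1n.
Qed.

Lemma sq_integrable_cst (c : R) : sq_integrable (fun=> c).
Proof. by split=> //; exact: integrable_cst_prob. Qed.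

Lemma sq_integrable_integrable (f : Omega -> R) : sq_integrable f -> L1 f.
Proof.
move=> if2; have := sq_integrable_integrableM if2 (sq_integrable_cst 1).
by under eq_fun do rewrite mulr1.
Qed.

Lemma sq_integrable_le (f g h : Omega -> R) : measurable_fun setT f ->
  sq_integrable g -> sq_integrable h ->
  (forall x, `|f x| <= `|g x| + `|h x|) -> sq_integrable f.
Proof.
move=> mf [mg ig] [mh ih] fgh; split=> //.
have igh := integrable_mulrl 2 (integrable_addr ig ih).
apply: (integrable_le _ igh) => [|x]; first exact: measurable_funX.
rewrite normrX -(real_normK (num_real (g x))) -(real_normK (num_real (h x))).
apply: (le_trans _ (sqrrD_le _ _)); rewrite ler_sqr ?nnegrE// addr_ge0.
Qed.

Lemma sq_integrableD (f g : Omega -> R) :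
  sq_integrable f -> sq_integrable g -> sq_integrable (fun x => f x + g x).
Proof.
move=> if2 ig2; apply: (sq_integrable_le _ if2 ig2) => [|x]; last exact: ler_normD.
by apply: measurable_funD; [case: if2|case: ig2].
Qed.

Lemma sq_integrableZ (k : R) (f : Omega -> R) :
  sq_integrable f -> sq_integrable (fun x => k * f x).
Proof.
move=> [mf if2]; split; first exact: measurable_funM.
under eq_fun do rewrite exprMn; exact: integrable_mulrl.
Qed.

Lemma sq_integrable_max (f g : Omega -> R) :
  sq_integrable f -> sq_integrable g ->
  sq_integrable (fun x => Order.max (f x) (g x)).
Proof.
move=> if2 ig2; apply: (sq_integrable_le _ if2 ig2) => [|x].
  by apply: measurable_maxr; [case: if2|case: ig2].
by rewrite /Order.max; case: ifP; rewrite ?lerDr ?lerDl.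
Qed.

Lemma sq_integrable_sum (n : nat) (f : nat -> Omega -> R) :
  (forall i, sq_integrable (f i)) ->
  sq_integrable (fun x => \sum_(0 <= i < n) f i x).
Proof.
move=> iF; elim: n => [|n IH].
  under eq_fun do rewrite big_geq//; exact: sq_integrable_cst.
under eq_fun do rewrite big_nat_recr//=; exact: sq_integrableD.
Qed.

Lemma integral_EFinD (f g : Omega -> R) : L1 f -> L1 g ->
  (\int[Pr]_x (f x + g x)%:E = \int[Pr]_x (f x)%:E + \int[Pr]_x (g x)%:E)%E.
Proof. by move=> iF ig; rewrite -integralD_EFin. Qed.

Lemma integral_EFinZ (k : R) (f : Omega -> R) : L1 f ->
  (\int[Pr]_x (k * f x)%:E = k%:E * \int[Pr]_x (f x)%:E)%E.
Proof. by move=> iF; rewrite -integralZl. Qed.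

Lemma integral_EFin_sum (I : Type) (s : seq I) (f : I -> Omega -> R) :
  (forall i, L1 (f i)) ->
  (\int[Pr]_x (\sum_(i <- s) f i x)%:E = \sum_(i <- s) \int[Pr]_x (f i x)%:E)%E.
Proof.
move=> iF; elim: s => [|i s IH].
  by rewrite big_nil; apply: integral0_eq => x _; rewrite big_nil.
under eq_integral do rewrite big_cons.
by rewrite integral_EFinD// ?IH ?big_cons//; exact: integrable_sumr.
Qed.

Lemma integral_cst_prob (c : R) : (\int[Pr]_x c%:E = c%:E)%E.
Proof. by have := expectation_cst Pr c; rewrite unlock. Qed.

Lemma sq_integrable_dominated (f g : Omega -> R) : measurable_fun setT f ->
  L1 g -> (forall x, f x ^+ 2 <= g x) -> sq_integrable f.
Proof.
move=> mf ig fg; split=> //; apply: (integrable_le _ ig) => [|x].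
  exact: measurable_funX.
by rewrite normrX real_normK ?num_real.
Qed.

Lemma integrable_of_bound (f : Omega -> R) (M : \bar R) :
  measurable_fun setT f -> (forall x, 0 <= f x) ->
  (\int[Pr]_x (f x)%:E <= M)%E -> (M < +oo)%E -> L1 f.
Proof.
move=> mf f0 fM Moo; apply/integrableP; split; first exact/measurable_EFinP.
rewrite (le_lt_trans _ Moo)// (le_trans _ fM)//.
by under eq_integral do rewrite /= ger0_norm//.
Qed.

(** Borel-Cantelli in integrated form: the series of the [f n] has a finite integral, hence
    converges almost everywhere, and its terms tend to 0. *)
Lemma ae_cvg0_summable (f : nat -> Omega -> R) :
  (forall n, measurable_fun setT (f n)) -> (forall n x, 0 <= f n x) ->
  (\sum_(0 <= n <oo) \int[Pr]_x (f n x)%:E < +oo)%E ->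
  {ae Pr, forall x, f ^~ x @ \oo --> 0}.
Proof.
move=> mf f0; have mEf n : measurable_fun setT (EFin \o f n) by exact/measurable_EFinP.
have Ef0 n x : (0 <= (f n x)%:E)%E by rewrite lee_fin.
rewrite -integral_nneseries//= => sumoo.
have int : Pr.-integrable setT (fun x => \sum_(0 <= n <oo) (f n x)%:E)%E.
  apply/integrableP; split.
    apply: (@ge0_emeasurable_sum _ _ _ _ (fun n x => (f n x)%:E) xpredT).
      by move=> k x _ _; exact: Ef0.
    by move=> k _; exact: mEf.
  by under eq_integral do rewrite gee0_abs ?nneseries_ge0//.
have := integrable_ae measurableT int.
apply: filterS => x /(_ I); rewrite ge0_fin_numE ?nneseries_ge0// => xoo.
apply: cvg_series_cvg_0; exact: nnseries_is_cvg.
Qed.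

End square_integrable.

(** * Doob's inequality and strong laws of large numbers *)

Definition running_sum {R : pzRingType} (d : nat -> R) (n : nat) : R :=
  \sum_(0 <= k < n) d k.

(** Starting at 0 makes the maximum nonnegative but one-sided; large negative sums are caught by
    passing to the opposite sequence. *)
Fixpoint running_max {R : realDomainType} (d : nat -> R) (n : nat) : R :=
  if n is m.+1 then Order.max (running_max d m) (running_sum d n) else 0.

(** The coefficient of [d n] when four times the squared partial sum, minus four times the sum of
    the [M k * d k], is expanded as one sum. It involves only the [d k] with [k < n]. *)
Definition doob_weight {R : realDomainType} (d : nat -> R) (n : nat) : R :=
  8 * running_sum d n - 4 * running_max d n.

Section pathwise_doob.
Context {R : realFieldType}.
Implicit Types d : nat -> R.

Lemma running_sumS d n : running_sum d n.+1 = running_sum d n + d n.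
Proof. by rewrite /running_sum big_nat_recr. Qed.

Lemma running_max_ge0 d n : 0 <= running_max d n.
Proof. by elim: n => //= n IH; rewrite le_max IH. Qed.

Lemma running_sum_le_max d m n : (m <= n)%N -> running_sum d m <= running_max d n.
Proof.
elim: n => [|n IH].
  by rewrite leqn0 => /eqP ->; rewrite /running_sum big_geq.
rewrite leq_eqVlt ltnS => /orP[/eqP ->|/IH mn] /=; rewrite le_max.
  by rewrite lexx orbT.
by rewrite mn.
Qed.

(* The maximum only grows at times where it equals the partial sum, so
   summation by parts bounds [sum M_k d_k] by [M_n S_n - M_n ^ 2 / 2]. *)
Lemma pathwise_doob d n :
  running_max d n ^+ 2 <=
  \sum_(0 <= k < n) (4 * d k ^+ 2 + doob_weight d k * d k).
Proof.
pose M := running_max d; pose S := running_sum d.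
have half m : M m ^+ 2 <= 2 * (M m * S m - \sum_(0 <= k < m) M k * d k).
  elim: m => [|m IH]; first by rewrite /M /= mul0r big_geq// subrr mulr0 expr0n.
  rewrite big_nat_recr//= /S running_sumS -/(S m).
  have -> : M m.+1 = Order.max (M m) (S m + d m) by rewrite /M /= running_sumS.
  move: (M m) (S m) (d m) IH => a s c.
  move: (\sum_(0 <= k < m) _) => t IH.
  by rewrite /Order.max; case: ifPn => _; have := sqr_ge0 (s + c - a); clear -IH; lra.
have sqr m : S m ^+ 2 = \sum_(0 <= k < m) (d k ^+ 2 + 2 * S k * d k).
  elim: m => [|m IH]; first by rewrite /S /running_sum !big_geq// expr0n.
  by rewrite big_nat_recr//= -IH /S running_sumS; ring.
have -> : \sum_(0 <= k < n) (4 * d k ^+ 2 + doob_weight d k * d k) =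
    4 * S n ^+ 2 - 4 * \sum_(0 <= k < n) M k * d k.
  rewrite sqr !mulr_sumr -sumrB; apply: eq_bigr => k _.
  by rewrite /doob_weight -/(M k) -/(S k); ring.
(* Doubling [half] and using [4 a s <= a ^ 2 + 4 s ^ 2] removes the maximum from the right-hand
   side. *)
have := half n; rewrite -/(M n); move: (M n) (S n) => a s.
by move: (\sum_(0 <= k < n) _) => t; clear; have := sqr_ge0 (a - 2 * s); lra.
Qed.

End pathwise_doob.

(** Any [T] lies between consecutive powers of 2, and a maximum up to the upper one controls the sum
    at [T]; [G] stands for a squared running maximum. *)
Lemma dyadic_cesaro_cvg0 {R : realType} (d G : nat -> R) :
  (forall m n, (m <= n)%N -> running_sum d m ^+ 2 <= G n) ->
  (fun n => 4 ^- n * G (2 ^ n)%N) @ \oo --> (0 : R) ->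
  (fun T => T%:R^-1 * \sum_(0 <= t < T) d t) @ \oo --> (0 : R).
Proof.
move=> dG /cvgrPdist_lt G0; apply/cvgrPdist_lt => eps eps0.
(* The division by 4 pays for replacing [4 ^- n.+1] by [4 ^- n]. *)
have e4 : 0 < eps ^+ 2 / 4 by rewrite divr_gt0// exprn_gt0.
have [N _ HN] := G0 _ e4.
exists (2 ^ N)%N => // T /= NT.
have T0 : (0 < T)%N by apply: leq_trans NT; rewrite expn_gt0.
have TR : 0 < T%:R :> R by rewrite ltr0n.
have /andP[lT uT] := trunc_log_bounds (isT : 1 < 2)%N T0.
set n := trunc_log 2 T in lT uT.
have Nn : (N <= n)%N by apply: trunc_log_max.
have := HN n.+1 (leqW Nn); rewrite sub0r normrN => Gn.
have := dG _ _ (ltnW uT); rewrite /running_sum => ST.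
rewrite sub0r normrN -ltr_sqr ?nnegrE ?normr_ge0 ?ltW//.
rewrite real_normK ?num_real// exprMn exprVn mulrC ltr_pdivrMr ?exprn_gt0//.
apply: (le_lt_trans ST).
have {Gn} : 4 ^- n.+1 * G (2 ^ n.+1)%N < eps ^+ 2 / 4.
  by apply: le_lt_trans Gn; exact: ler_norm.
rewrite mulrC ltr_pdivrMr ?exprn_gt0// => /lt_le_trans; apply.
rewrite [4 ^+ n.+1]exprS mulrA divfK ?pnatr_eq0// ler_wpM2l ?sqr_ge0//.
have -> : 4 ^+ n = (2 ^ n)%N%:R ^+ 2 :> R.
  by rewrite natrX -exprM mulnC exprM; congr (_ ^+ n); rewrite -natrX.
by rewrite ler_sqr ?nnegrE ?ler_nat.
Qed.

Lemma sub_sigma_measurable_fun {d : measure_display} {Omega : measurableType d}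
    {d' : measure_display} {T : sigmaRingType d'}
    (G : set (set Omega)) (f : Omega -> T) :
  G `<=` measurable ->
  measurable_fun [set: g_sigma_algebraType G] (f : g_sigma_algebraType G -> T) ->
  measurable_fun [set: Omega] f.
Proof.
move=> Gm mf _ Y mY; have := mf measurableT Y mY.
by apply: smallest_sub => //; exact: sigma_algebra_measurable.
Qed.

Section martingale.
Context {d : measure_display} {Omega : measurableType d} {R : realType}.
Variable Pr : probability Omega R.

(** Martingale differences without conditional expectations: for square-integrable [D n], a zero
    conditional mean given [F n] amounts to orthogonality to every square-integrable [Z] measurable
    for [F n]. The [F n] are generating families. *)
Definition orthogonal_to_past (F : nat -> set (set Omega))
    (D : nat -> Omega -> R) : Prop :=
  [/\ forall n, F n `<=` measurable,
      forall n, sq_integrable Pr (D n),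
      forall k n, (k < n)%N ->
        measurable_fun [set: g_sigma_algebraType (F n)]
          (D k : g_sigma_algebraType (F n) -> R)
    & forall n (Z : Omega -> R),
        measurable_fun [set: g_sigma_algebraType (F n)]
          (Z : g_sigma_algebraType (F n) -> R) ->
        sq_integrable Pr Z -> (\int[Pr]_x (Z x * D n x)%:E = 0)%E].

Lemma orthogonal_to_pastN F D : orthogonal_to_past F D ->
  orthogonal_to_past F (fun n x => - D n x).
Proof.
move=> [Fm D2 Da Do]; split=> //.
- by move=> n; under eq_fun do rewrite -mulN1r; exact: sq_integrableZ.
- by move=> k n kn; apply: measurableT_comp => //; exact: Da.
move=> n Z mZ Z2; under eq_integral do rewrite mulrN -mulN1r.
by rewrite integral_EFinZ ?Do ?mule0//; exact: sq_integrable_integrableM.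
Qed.

Variables (F : nat -> set (set Omega)) (D : nat -> Omega -> R).
Hypothesis DF : orthogonal_to_past F D.

Let S n x := running_sum (D ^~ x) n.
Let M n x := running_max (D ^~ x) n.

Let S2 n : sq_integrable Pr (S n).
Proof. by case: DF => _ D2 _ _; exact: sq_integrable_sum. Qed.

Let M2 n : sq_integrable Pr (M n).
Proof.
elim: n => [|n IH]; first exact: sq_integrable_cst.
exact: (sq_integrable_max IH (S2 n.+1)).
Qed.

Let S_pred n m : (m <= n)%N ->
  measurable_fun [set: g_sigma_algebraType (F n)] (S m : g_sigma_algebraType (F n) -> R).
Proof.
have [_ _ Da _] := DF.
elim: m => [|m IH] mn.
  rewrite (_ : S 0%N = fun=> 0); first exact: measurable_cst.
  by apply/funext => x; rewrite /S /running_sum big_geq.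
rewrite (_ : S m.+1 = fun x => S m x + D m x); last first.
  by apply/funext => x; rewrite /S running_sumS.
by apply: measurable_funD; [exact: IH (ltnW mn)|exact: Da].
Qed.

Let M_pred n m : (m <= n)%N ->
  measurable_fun [set: g_sigma_algebraType (F n)] (M m : g_sigma_algebraType (F n) -> R).
Proof.
elim: m => [|m IH] mn; first exact: measurable_cst.
by apply: measurable_maxr; [exact: IH (ltnW mn)|exact: S_pred].
Qed.

(** The pathwise inequality is integrated: its weights are predictable, so their products with [D k]
    have mean zero. No stopping time is involved. *)
Lemma doob_maximal_inequality n :
  (\int[Pr]_x ((running_max (D ^~ x) n) ^+ 2)%:E <=
   4%:E * \sum_(0 <= k < n) \int[Pr]_x (D k x ^+ 2)%:E)%E.
Proof.
have [_ D2 _ Do] := DF.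
have iD2 k : Pr.-integrable setT (EFin \o (fun x => D k x ^+ 2)) by case: (D2 k).
pose Z k x := doob_weight (D ^~ x) k.
have Z2 k : sq_integrable Pr (Z k).
  rewrite /Z /doob_weight; under eq_fun do rewrite -mulNr.
  by apply: sq_integrableD; apply: sq_integrableZ; [exact: S2|exact: M2].
have iZD k := sq_integrable_integrableM (Z2 k) (D2 k).
have i4D k := integrable_mulrl 4 (iD2 k).
have isum : forall k, Pr.-integrable setT
    (EFin \o (fun x => 4 * D k x ^+ 2 + Z k x * D k x)).
  by move=> k; exact: integrable_addr.
apply: (@le_trans _ _ (\int[Pr]_x
    (\sum_(0 <= k < n) (4 * D k x ^+ 2 + Z k x * D k x))%:E)%E).
  apply: le_integral => //.
  - by case: (M2 n).
  - exact: integrable_sumr.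
  - by move=> x _; rewrite lee_fin pathwise_doob.
rewrite integral_EFin_sum// ge0_sume_distrr; last first.
  by move=> k _ ; apply: integral_ge0 => x _; rewrite lee_fin sqr_ge0.
apply: lee_sum => k _.
rewrite integral_EFinD// integral_EFinZ//.
suff -> : (\int[Pr]_x (Z k x * D k x)%:E = 0)%E by rewrite adde0.
apply: Do => //.
pose T := g_sigma_algebraType (F k).
have mS : measurable_fun [set: T] (fun x : T => 8 * S k x).
  by apply: measurable_funM => //; exact: S_pred.
have mM : measurable_fun [set: T] (fun x : T => 4 * M k x).
  by apply: measurable_funM => //; exact: M_pred.
exact: (measurable_funB mS mM).
Qed.

End martingale.

Section martingale_slln.
Context {d : measure_display} {Omega : measurableType d} {R : realType}.
Variable Pr : probability Omega R.

(** The summability hypothesis is the dyadic form of Kolmogorov's condition on the series of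
    [E[D_k ^ 2] / k ^ 2]; it is what the maximal inequality at the times [2 ^ n] asks for. *)
Lemma martingale_slln F (D : nat -> Omega -> R) :
  orthogonal_to_past Pr F D ->
  (\sum_(0 <= n <oo) (4 ^- n)%:E *
     \sum_(0 <= k < 2 ^ n) \int[Pr]_x (D k x ^+ 2)%:E < +oo)%E ->
  {ae Pr, forall x, (fun T => T%:R^-1 * \sum_(0 <= t < T) D t x) @ \oo --> (0 : R)}.
Proof.
move=> DF sumoo; have NF := orthogonal_to_pastN DF.
have D2 n : sq_integrable Pr (D n) by case: DF.
pose N n x := - D n x.
have N2 n : sq_integrable Pr (N n) by case: NF => _ /(_ n).
(* Both signs are needed to dominate the square of the partial sum, hence the constant 8 below,
   twice Doob's 4. *)
pose G n x := running_max (D ^~ x) n ^+ 2 + running_max (N ^~ x) n ^+ 2.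
have mmax (E : nat -> Omega -> R) n : (forall k, sq_integrable Pr (E k)) ->
    measurable_fun setT (fun x => running_max (E ^~ x) n).
  move=> E2; elim: n => [|n IH]; first exact: measurable_cst.
  by apply: measurable_maxr => //; case: (sq_integrable_sum n.+1 E2).
have G0 n x : 0 <= G n x by rewrite addr_ge0 ?sqr_ge0.
have mG n : measurable_fun setT (G n).
  by apply: measurable_funD; apply: measurable_funX; exact: mmax.
have IG n : (\int[Pr]_x (G n x)%:E <=
    8%:E * \sum_(0 <= k < n) \int[Pr]_x (D k x ^+ 2)%:E)%E.
  under eq_integral do rewrite EFinD.
  rewrite ge0_integralD//=; last 4 first.
  - by move=> x _; rewrite lee_fin sqr_ge0.
  - by apply/measurable_EFinP/measurable_funX; exact: mmax.
  - by move=> x _; rewrite lee_fin sqr_ge0.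
  - by apply/measurable_EFinP/measurable_funX; exact: mmax.
  have := doob_maximal_inequality NF n.
  rewrite (_ : (\sum_(0 <= k < n) _ = \sum_(0 <= k < n) \int[Pr]_x (D k x ^+ 2)%:E)%E); last first.
    by apply: eq_bigr => k _; apply: eq_integral => x _; rewrite sqrrN.
  have -> : 8%:E = (4%:E + 4%:E)%E :> \bar R by rewrite -EFinD -natrD.
  rewrite ge0_muleDl ?lee_fin// => NM; apply: leeD => //.
  exact: doob_maximal_inequality DF n.
pose f n x := 4 ^- n * G (2 ^ n)%N x.
have : {ae Pr, forall x, f ^~ x @ \oo --> (0 : R)}.
  apply: ae_cvg0_summable.
  - by move=> n; apply: measurable_funM => //; exact: mG.
  - by move=> n x; rewrite mulr_ge0// invr_ge0 exprn_ge0.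
  apply: (@le_lt_trans _ _ (8%:E * \sum_(0 <= n <oo) (4 ^- n)%:E *
     \sum_(0 <= k < 2 ^ n) \int[Pr]_x (D k x ^+ 2)%:E)%E); last first.
    by rewrite lte_mul_pinfty.
  have s0 n : (0 <= \sum_(0 <= k < n) \int[Pr]_x (D k x ^+ 2)%:E)%E.
    by apply: sume_ge0 => k _; apply: integral_ge0 => x _; rewrite lee_fin sqr_ge0.
  have q0 n : (0 <= (4 ^- n)%:E :> \bar R)%E by rewrite lee_fin invr_ge0 exprn_ge0.
  rewrite -nneseriesZl; last by move=> n _; rewrite mule_ge0.
  apply: lee_nneseries => [n _ _|n _].
    by apply: integral_ge0 => x _; rewrite lee_fin mulr_ge0// -lee_fin.
  under eq_integral do rewrite EFinM.
  have c0 : 0 <= 4 ^- n :> R by rewrite -lee_fin.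
  rewrite ge0_integralZl_EFin//; [|by move=> x _; rewrite lee_fin|exact/measurable_EFinP/mG].
  by rewrite muleCA lee_pmul// integral_ge0// => x _; rewrite lee_fin.
move=> f_cvg; apply: filterS f_cvg => x fx; apply: (@dyadic_cesaro_cvg0 _ _ (G ^~ x)) fx => m n mn.
have Dx := running_sum_le_max (D ^~ x) mn.
have Nx := running_sum_le_max (N ^~ x) mn.
have NE : running_sum (N ^~ x) m = - running_sum (D ^~ x) m.
  by rewrite /running_sum sumrN.
rewrite NE in Nx; rewrite /G.
have [s0|s0] := leP 0 (running_sum (D ^~ x) m).
  rewrite (@le_trans _ _ (running_max (D ^~ x) n ^+ 2))//.
    by rewrite ler_sqr ?nnegrE ?running_max_ge0.
  by rewrite lerDl sqr_ge0.
rewrite (@le_trans _ _ (running_max (N ^~ x) n ^+ 2))//.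
  by rewrite -sqrrN ler_sqr ?nnegrE ?running_max_ge0// oppr_ge0 ltW.
by rewrite lerDr sqr_ge0.
Qed.

End martingale_slln.

(** * Laws, independence and expectations of products *)

Lemma ge0_integral_eq_law {d d' : measure_display} {Omega : measurableType d}
    {T : measurableType d'} {R : realType} (Pr : probability Omega R)
    (X Y : Omega -> T) (f : T -> \bar R) :
  measurable_fun setT X -> measurable_fun setT Y ->
  (forall B, measurable B -> Pr (X @^-1` B) = Pr (Y @^-1` B)) ->
  measurable_fun setT f -> (forall z, (0 <= f z)%E) ->
  (\int[Pr]_x f (X x) = \int[Pr]_x f (Y x))%E.
Proof.
move=> mX mY XY mf f0.
pose X' : {mfun Omega >-> T} := mfun_Sub (mem_set mX).
pose Y' : {mfun Omega >-> T} := mfun_Sub (mem_set mY).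
rewrite -[LHS](@ge0_integral_distribution _ _ _ _ _ Pr X' f)//.
rewrite -[RHS](@ge0_integral_distribution _ _ _ _ _ Pr Y' f)//.
by apply: eq_measure_integral => B mB _; exact: XY.
Qed.

Section independence.
Context {d : measure_display} {Omega : measurableType d} {R : realType}.
Variable Pr : probability Omega R.

Definition independent_of {d'} {T : measurableType d'}
    (G : set (set Omega)) (W : Omega -> T) : Prop :=
  forall E B, <<s G >> E -> measurable B ->
    (Pr (E `&` W @^-1` B) = Pr E * Pr (W @^-1` B))%E.

Lemma independent_of_comp {d1 d2} {T1 : measurableType d1} {T2 : measurableType d2}
    (G : set (set Omega)) (W : Omega -> T1) (g : T1 -> T2) :
  measurable_fun setT g -> independent_of G W -> independent_of G (g \o W).
Proof.
move=> mg GW E B GE mB; rewrite comp_preimage; apply: GW => //.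
by rewrite -[_ @^-1` _]setTI; exact: mg.
Qed.

Section product_expectation.
Variables (X Y : Omega -> R).
Hypotheses (mX : measurable_fun setT X) (mY : measurable_fun setT Y).
Hypothesis XY : forall A B, measurable A -> measurable B ->
  (Pr (X @^-1` A `&` Y @^-1` B) = Pr (X @^-1` A) * Pr (Y @^-1` B))%E.

Let X' : {mfun Omega >-> R} := mfun_Sub (mem_set mX).
Let Y' : {mfun Omega >-> R} := mfun_Sub (mem_set mY).

Let mXY : measurable_fun setT (fun x => (X x, Y x)).
Proof. exact/measurable_fun_pair. Qed.

Let XY' : {mfun Omega >-> (R * R)%type} := mfun_Sub (mem_set mXY).

(** Independence fixes the joint law on rectangles, and these identify it with the product of the
    marginals, which opens the way to Fubini. *)
Let joint_law (f : R * R -> \bar R) :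
  (\int[distribution Pr X' \x distribution Pr Y']_z f z =
   \int[distribution Pr XY']_z f z)%E.
Proof.
apply: eq_measure_integral => A mA _.
apply: (@product_measure_unique _ _ _ _ _ (distribution Pr X')
  (distribution Pr Y') (distribution Pr XY')) => //.
Qed.

Lemma ge0_integral_indepM (f g : R -> \bar R) :
  measurable_fun setT f -> measurable_fun setT g ->
  (forall z, 0 <= f z)%E -> (forall z, 0 <= g z)%E ->
  (\int[Pr]_x (f (X x) * g (Y x)) = \int[Pr]_x f (X x) * \int[Pr]_x g (Y x))%E.
Proof.
move=> mf mg f0 g0.
have mfg : measurable_fun setT (fun z : R * R => f z.1 * g z.2)%E.
  by apply: emeasurable_funM; apply: measurableT_comp.
have fg0 (z : R * R) : (0 <= f z.1 * g z.2)%E by rewrite mule_ge0.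
rewrite -(@ge0_integral_distribution _ _ _ _ _ Pr XY' _ mfg fg0) -joint_law.
rewrite fubini_tonelli1//= /fubini_F /=.
under eq_integral do rewrite ge0_integralZl//.
rewrite (ge0_integral_distribution Y' mg g0).
have gY0 : (0 <= \int[Pr]_x (g \o Y') x)%E by apply: integral_ge0 => x _; exact: g0.
rewrite ge0_integralZr//.
by rewrite (ge0_integral_distribution X' mf f0).
Qed.

Hypotheses (iX : Pr.-integrable setT (EFin \o X)) (iY : Pr.-integrable setT (EFin \o Y)).

(** Independence replaces Cauchy-Schwarz: first moments suffice, which admits a factor that is
    itself a product of square-integrable variables. *)
Lemma integrable_indepM : Pr.-integrable setT (EFin \o (fun x => X x * Y x)).
Proof.
apply/integrableP; split; first exact/measurable_EFinP/measurable_funM.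
under eq_integral do rewrite /= normrM EFinM.
have mN : measurable_fun setT (fun z : R => `|z|%:E) by exact/measurable_EFinP.
rewrite (ge0_integral_indepM mN mN)//.
have /integrableP[_ iX'] := iX; have /integrableP[_ iY'] := iY.
rewrite lte_mul_pinfty//; first exact: integral_ge0.
by rewrite ge0_fin_numE ?integral_ge0.
Qed.

Lemma integral_indepM :
  (\int[Pr]_x (X x * Y x)%:E = \int[Pr]_x (X x)%:E * \int[Pr]_x (Y x)%:E)%E.
Proof.
pose f (z : R * R) := (z.1 * z.2)%:E.
have mf : measurable_fun setT f.
  by apply/measurable_EFinP; apply: measurable_funM.
have idX : (distribution Pr X').-integrable setT EFin.
  apply/integrableP; split; first exact/measurable_EFinP.
  rewrite (ge0_integral_distribution X')//; last exact/measurableT_comp.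
  by have /integrableP[] := iX.
have idY : (distribution Pr Y').-integrable setT EFin.
  apply/integrableP; split; first exact/measurable_EFinP.
  rewrite (ge0_integral_distribution Y')//; last exact/measurableT_comp.
  by have /integrableP[] := iY.
have idXY : (distribution Pr X' \x distribution Pr Y')%E.-integrable setT f.
  apply/integrableP; split => //.
  rewrite joint_law (ge0_integral_distribution XY')//; last exact/measurableT_comp.
  by have /integrableP[] := integrable_indepM.
have mE : measurable_fun [set: R] (@EFin R) by exact/measurable_EFinP.
transitivity (\int[distribution Pr X' \x distribution Pr Y']_z f z)%E.
  rewrite joint_law integral_distribution//; exact: integrable_indepM.
rewrite -integral12_prod_meas1//= /fubini_F /f /=.
have inner (x : R) : (\int[distribution Pr Y']_y (x * y)%:E =
    x%:E * \int[distribution Pr Y']_y y%:E)%E by rewrite -integralZl.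
under eq_integral do rewrite inner.
have -> : (\int[Pr]_x (X x)%:E = \int[distribution Pr X']_x x%:E)%E.
  by rewrite (@integral_distribution _ _ _ _ _ Pr X' EFin).
rewrite (@integral_distribution _ _ _ _ _ Pr Y' EFin)//.
have /fineK <- : (\int[Pr]_x (Y x)%:E)%E \is a fin_num.
  exact: integrable_fin_num.
by rewrite integralZr.
Qed.

End product_expectation.

Lemma past_noise_product {d'} {T : measurableType d'} (G : set (set Omega))
    (W : Omega -> T) (Z : Omega -> R) (g : T -> R) :
  independent_of G W ->
  measurable_fun [set: g_sigma_algebraType G] (Z : g_sigma_algebraType G -> R) ->
  measurable_fun setT g -> forall A B, measurable A -> measurable B ->
  (Pr (Z @^-1` A `&` (g \o W) @^-1` B) =
    Pr (Z @^-1` A) * Pr ((g \o W) @^-1` B))%E.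
Proof.
move=> GW mZ mg A B mA mB.
apply: (independent_of_comp mg GW) => //.
by have := mZ measurableT A mA; rewrite setTI.
Qed.

End independence.

Lemma nneseries_le {R : realType} (u : nat -> \bar R) (c : \bar R) :
  (forall n, 0 <= u n)%E -> (forall N, \sum_(0 <= n < N) u n <= c)%E ->
  (\sum_(0 <= n <oo) u n <= c)%E.
Proof.
by move=> u0 uc; apply: lime_le; [exact: is_cvg_nneseries|exact: nearW].
Qed.

Lemma sum_half_powers {R : realFieldType} N :
  \sum_(0 <= n < N) (2 ^- n : R) = 2 - 2 * 2 ^- N.
Proof.
elim: N => [|N IH]; first by rewrite big_geq// expr0 invr1 mulr1 subrr.
rewrite big_nat_recr//= IH exprS invfM mulrA divff ?pnatr_eq0// mul1r; ring.
Qed.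

Lemma half_powers_cvg {R : realType} (C : R) : 0 <= C ->
  (\sum_(0 <= n <oo) (2 ^- n * C)%:E < +oo)%E.
Proof.
move=> C0; apply: (@le_lt_trans _ _ (2 * C)%:E); last exact: ltry.
apply: nneseries_le => [n|N].
  by rewrite lee_fin mulr_ge0// invr_ge0 exprn_ge0.
rewrite sumEFin lee_fin -mulr_suml sum_half_powers ler_wpM2r//.
by rewrite gerBl mulr_ge0// invr_ge0 exprn_ge0.
Qed.

Lemma quarter_mul_pow2 {R : numFieldType} n : 4 ^- n * (2 ^ n)%N%:R = 2 ^- n :> R.
Proof.
have -> : 4 = 2 * 2 :> R by rewrite -natrM.
by rewrite exprMn invfM natrX -mulrA mulVf ?mulr1// expf_neq0// pnatr_eq0.
Qed.

(** * Products of a predictable factor and a fresh noise *)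

Section martingale_products.
Context {d : measure_display} {Omega : measurableType d} {R : realType}.
Variable Pr : probability Omega R.
Context {d' : measure_display} {T : measurableType d'}.
Variables (F : nat -> set (set Omega)) (Y : nat -> Omega -> R).
Variables (W : nat -> Omega -> T) (g : nat -> T -> R).
Hypotheses (Fm : forall n, F n `<=` measurable)
  (Yp : forall n, measurable_fun [set: g_sigma_algebraType (F n)]
     (Y n : g_sigma_algebraType (F n) -> R))
  (Y2 : forall n, sq_integrable Pr (Y n))
  (FW : forall n, independent_of Pr (F n) (W n))
  (mg : forall n, measurable_fun setT (g n))
  (gW2 : forall n, sq_integrable Pr (g n \o W n)).

(** Independence splits the second moment of the product, so that no fourth moment of either factor
    enters. *)
Lemma integral_product_sqr n :
  (\int[Pr]_x ((Y n x * g n (W n x)) ^+ 2)%:E =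
   \int[Pr]_x (Y n x ^+ 2)%:E * \int[Pr]_x (g n (W n x) ^+ 2)%:E)%E.
Proof.
under eq_integral do rewrite exprMn EFinM.
have msqr : measurable_fun setT (fun z : R => (z ^+ 2)%:E).
  by apply/measurable_EFinP; exact: measurable_funX.
have sqr0 (z : R) : (0 <= (z ^+ 2)%:E)%E by rewrite lee_fin sqr_ge0.
apply: (@ge0_integral_indepM _ _ _ Pr (Y n) (g n \o W n) _ _ _ _ _ msqr msqr sqr0 sqr0).
- by case: (Y2 n).
- by case: (gW2 n).
- exact: (past_noise_product (@FW n) (@Yp n) (@mg n)).
Qed.

(** For [Z] from the past, [Z * Y n] is again from the past and is integrable; the expectation
    factors, and the centred noise factor annihilates it. *)
Lemma orthogonal_to_past_product :
  (forall n, \int[Pr]_x (g n (W n x))%:E = 0)%E ->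
  (forall k n, (k < n)%N -> measurable_fun [set: g_sigma_algebraType (F n)]
     ((fun x => Y k x * g k (W k x)) : g_sigma_algebraType (F n) -> R)) ->
  orthogonal_to_past Pr F (fun n x => Y n x * g n (W n x)).
Proof.
move=> gW0 Da; split=> //.
  move=> n; have mD : measurable_fun setT (fun x => Y n x * g n (W n x)).
    by apply: measurable_funM; [case: (Y2 n)|case: (gW2 n)].
  split=> //; apply: (@integrable_of_bound _ _ _ _ _
    (\int[Pr]_x (Y n x ^+ 2)%:E * \int[Pr]_x (g n (W n x) ^+ 2)%:E)%E).
  - exact: measurable_funX.
  - by move=> x; rewrite sqr_ge0.
  - by rewrite integral_product_sqr.
  have [[_ iY] [_ ig]] := (Y2 n, gW2 n).
  rewrite lte_mul_pinfty//.
  - by apply: integral_ge0 => x _; rewrite lee_fin sqr_ge0.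
  - exact: integrable_fin_num iY.
  - by have := integrable_lty measurableT ig.
move=> n Z mZ Z2.
have mZY : measurable_fun [set: g_sigma_algebraType (F n)]
    ((fun x => Z x * Y n x) : g_sigma_algebraType (F n) -> R).
  by apply: (@measurable_funM _ (g_sigma_algebraType (F n))) => //; exact: Yp.
under eq_integral do rewrite mulrA.
rewrite (@integral_indepM _ _ _ Pr (fun x => Z x * Y n x) (g n \o W n)).
- by rewrite [X in (_ * X)%E]gW0 mule0.
- exact: (sub_sigma_measurable_fun (@Fm n) mZY).
- by case: (gW2 n).
- exact: (past_noise_product (@FW n) mZY (@mg n)).
- exact: sq_integrable_integrableM.
- exact: sq_integrable_integrable.
Qed.

End martingale_products.

(** The first [2 ^ n] terms contribute at most [2 ^ n * C], which the weight [4 ^- n] makes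
    summable. *)
Lemma martingale_slln_bounded {d : measure_display} {Omega : measurableType d}
    {R : realType} (Pr : probability Omega R) F (D : nat -> Omega -> R) (C : R) :
  orthogonal_to_past Pr F D -> (forall k, \int[Pr]_x (D k x ^+ 2)%:E <= C%:E)%E ->
  {ae Pr, forall x, (fun T => T%:R^-1 * \sum_(0 <= t < T) D t x) @ \oo --> (0 : R)}.
Proof.
move=> DF DC; apply: martingale_slln DF _.
have C0 : 0 <= C.
  by rewrite -lee_fin (le_trans _ (DC 0%N))// integral_ge0// => x _; rewrite lee_fin sqr_ge0.
apply: le_lt_trans (half_powers_cvg C0); apply: lee_nneseries => n _ => [_|].
  rewrite mule_ge0// ?lee_fin ?invr_ge0 ?exprn_ge0// sume_ge0// => k _.
  by apply: integral_ge0 => x _; rewrite lee_fin sqr_ge0.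
apply: (@le_trans _ _ ((4 ^- n)%:E * \sum_(0 <= k < 2 ^ n) C%:E)%E).
  by rewrite lee_wpmul2l ?lee_fin ?invr_ge0 ?exprn_ge0// lee_sum.
by rewrite sumEFin -EFinM lee_fin sumr_const_nat subn0 -[C *+ _]mulr_natl mulrA quarter_mul_pow2.
Qed.

Definition cesaro_mean {R : fieldType} (f : nat -> R) (T : nat) : R :=
  T%:R^-1 * \sum_(0 <= t < T) f t.

Section cesaro_mean.
Context {R : realType}.
Implicit Types f g : nat -> R.

Lemma cesaro_meanD f g T :
  cesaro_mean (fun t => f t + g t) T = cesaro_mean f T + cesaro_mean g T.
Proof. by rewrite /cesaro_mean big_split mulrDr. Qed.

Lemma cesaro_meanZ (k : R) f T : cesaro_mean (fun t => k * f t) T = k * cesaro_mean f T.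
Proof. by rewrite /cesaro_mean -mulr_sumr mulrCA. Qed.

Lemma cesaro_mean_cvg f (l : R) : f @ \oo --> l -> cesaro_mean f @ \oo --> l.
Proof. by move=> /cesaro fl; rewrite -cvg_shiftS; exact: fl. Qed.

End cesaro_mean.

(** * Truncation and Kolmogorov's strong law for integrable variables *)

Definition truncation {R : numDomainType} (c x : R) : R :=
  if `|x| <= c then x else 0.

Section truncation.
Context {R : realType}.

Lemma measurable_truncation (c : R) : measurable_fun setT (truncation c).
Proof.
by apply: measurable_fun_ifT => //; apply: measurable_fun_ler.
Qed.

Lemma normr_truncation_le (c x : R) : `|truncation c x| <= `|x|.
Proof. by rewrite /truncation; case: ifP => // _; rewrite normr0. Qed.

Lemma normr_truncation_bound (c x : R) : 0 <= c -> `|truncation c x| <= c.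
Proof. by rewrite /truncation; case: ifP => // _; rewrite normr0. Qed.

Lemma truncation_sqr_mono (c c' x : R) : c <= c' ->
  truncation c x ^+ 2 <= truncation c' x ^+ 2.
Proof.
rewrite /truncation => cc'; case: ifPn => [xc|_]; last by rewrite expr0n sqr_ge0.
by rewrite (le_trans xc cc').
Qed.

Lemma truncation_cvg (x : R) : (fun t : nat => truncation t%:R x) @ \oo --> x.
Proof.
apply: cvg_near_cst; exists (Num.bound `|x|) => // t /= xt.
rewrite /truncation ifT// ltW// (lt_le_trans (archi_boundP (normr_ge0 x)))//.
by rewrite ler_nat.
Qed.

(* The terms vanish until [2 ^ n >= |x|], after which they are geometric. *)
Lemma dyadic_truncation_sum (x : R) N :
  \sum_(0 <= n < N) 2 ^- n * truncation (2 ^+ n) x ^+ 2 <= 2 * `|x|.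
Proof.
have pow2 n : 2 ^- n * 2 ^+ n = 1 :> R by rewrite mulVf// expf_neq0// pnatr_eq0.
have inv0 n : 0 < 2 ^- n :> R by rewrite invr_gt0 exprn_gt0.
suff : \sum_(0 <= n < N) 2 ^- n * truncation (2 ^+ n) x ^+ 2 <=
    Order.max 0 (2 * `|x| - 2 * 2 ^- N * `|x| ^+ 2).
  move=> /le_trans; apply; rewrite ge_max mulr_ge0//= gerBl.
  by rewrite mulr_ge0 ?sqr_ge0// mulr_ge0// ltW.
elim: N => [|N IH]; first by rewrite big_geq// le_max lexx.
rewrite big_nat_recr//=.
have -> : 2 * 2 ^- N.+1 = 2 ^- N :> R.
  by rewrite exprS invfM mulrA divff ?pnatr_eq0// mul1r.
have [a a0 aE] : exists2 a : R, 0 <= a & `|x| = a by exists `|x|.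
have inv1 := inv0 N; have p1 := pow2 N.
have trE : truncation (2 ^+ N) x ^+ 2 = if a <= 2 ^+ N then a ^+ 2 else 0.
  by rewrite /truncation aE; case: ifP => _; rewrite ?expr0n// -aE real_normK ?num_real.
rewrite trE aE in IH *; move: IH inv1 p1.
move: (\sum_(0 <= n < N) _) (2 ^+ N : R) (2 ^- N : R) => s e c IH c0 ce.
have ca0 : 0 <= c * a ^+ 2 by rewrite mulr_ge0 ?sqr_ge0// ltW.
have [ae|_] := leP a e; last first.
  rewrite mulr0 addr0; apply: (le_trans IH).
  rewrite ge_max !le_max lexx /=; apply/orP; right.
  lra.
have ca : c * a ^+ 2 <= a.
  have cae : c * a * a <= c * a * e by rewrite ler_wpM2l// mulr_ge0// ltW.
  by rewrite expr2 mulrA (le_trans cae)// mulrAC ce mul1r.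
rewrite le_max; apply/orP; right.
rewrite -lerBrDr; apply: (le_trans IH); rewrite ge_max; apply/andP; split; lra.
Qed.

(** The sum counts natural numbers below the modulus of [x]. Integrated at [X 0], it bounds the
    series of the probabilities that [X t] exceeds [t] in modulus by the first absolute moment plus
    1. *)
Lemma tail_indicator_sum (x : R) N :
  \sum_(0 <= t < N) (t%:R < `|x|)%R%:R <= `|x| + 1 :> R.
Proof.
have le_N n : \sum_(0 <= t < n) (t%:R < `|x|)%R%:R <= n%:R :> R.
  elim: n => [|n IH]; first by rewrite big_geq.
  by rewrite big_nat_recr//= -natr1 lerD//; case: (_ < _); rewrite ?ler01.
elim: N => [|N IH]; first by rewrite big_geq// addr_ge0.
rewrite big_nat_recr//=; have [Nx|_] := ltP N%:R `|x|; last by rewrite addr0.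
by rewrite lerD2r (le_trans (le_N N))// ltW.
Qed.

End truncation.

Section iid_slln.
Context {d : measure_display} {Omega : measurableType d} {R : realType}.
Variable Pr : probability Omega R.
Variables (F : nat -> set (set Omega)) (X : nat -> Omega -> R).
Hypotheses (Fm : forall n, F n `<=` measurable)
  (mX : forall n, measurable_fun setT (X n))
  (Xa : forall k n, (k < n)%N -> measurable_fun [set: g_sigma_algebraType (F n)]
     (X k : g_sigma_algebraType (F n) -> R))
  (FX : forall n, independent_of Pr (F n) (X n))
  (X_law : forall s t (B : set R), measurable B ->
     Pr (X s @^-1` B) = Pr (X t @^-1` B))
  (iX : Pr.-integrable setT (EFin \o X 0%N)).

Let law (f : R -> R) t : measurable_fun setT f -> (forall z, 0 <= f z) ->
  (\int[Pr]_x (f (X t x))%:E = \int[Pr]_x (f (X 0%N x))%:E)%E.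
Proof.
move=> mf f0; apply: (ge0_integral_eq_law (@mX t) (@mX 0%N)
  (f := fun z => (f z)%:E)) => //.
  by move=> B mB; exact: X_law.
exact/measurable_EFinP.
Qed.

(** The level grows with [t]: high enough for almost surely only finitely many terms to change, low
    enough for the variances to meet Kolmogorov's condition. *)
Let Y t x := truncation t%:R (X t x).

Let mY t : measurable_fun setT (Y t).
Proof. by apply: measurableT_comp => //; exact: measurable_truncation. Qed.

Let Y2 t : sq_integrable Pr (Y t).
Proof.
apply: (sq_integrable_dominated (mY t) (integrable_cst_prob Pr (t%:R ^+ 2))) => x.
rewrite -real_normK ?num_real// ler_sqr ?nnegrE//.
exact: normr_truncation_bound.
Qed.

Let iY t := sq_integrable_integrable (Y2 t).

Let e t := fine (\int[Pr]_x (Y t x)%:E)%E.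

Let eE t : (\int[Pr]_x (Y t x)%:E = (e t)%:E)%E.
Proof. by rewrite /e fineK//; apply: integrable_fin_num (iY t). Qed.

Let D t x := Y t x - e t.

(** The factor 1 casts the centred truncation as a product, so that [orthogonal_to_past_product]
    applies. *)
Let D_eq t x : D t x = 1 * (truncation t%:R (X t x) - e t).
Proof. by rewrite mul1r. Qed.

Let D2 t : sq_integrable Pr (D t).
Proof. exact: (sq_integrableD (Y2 t) (sq_integrable_cst Pr (- e t))). Qed.

Let D_orthogonal : orthogonal_to_past Pr F D.
Proof.
have -> : D = fun t x => 1 * (truncation t%:R (X t x) - e t).
  by apply/funext => t; apply/funext => x; exact: D_eq.
apply: (@orthogonal_to_past_product _ _ _ Pr _ _ F (fun _ _ => 1) X
  (fun t z => truncation t%:R z - e t)) => //.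
- by move=> t; exact: sq_integrable_cst.
- move=> t; apply: measurable_funB; last exact: measurable_cst.
  exact: measurable_truncation.
- move=> t; rewrite (integral_EFinD (iY t) (integrable_cst_prob Pr (- e t))).
  by rewrite eE integral_cst_prob -EFinD subrr.
move=> k n kn; under eq_fun do rewrite mul1r.
apply: (@measurable_funB _ (g_sigma_algebraType (F n))) => //.
exact: (measurableT_comp (measurable_truncation _) (Xa kn)).
Qed.

Let int_D2 t : (\int[Pr]_x (D t x ^+ 2)%:E <= \int[Pr]_x (Y t x ^+ 2)%:E)%E.
Proof.
have iY2 : Pr.-integrable setT (EFin \o (fun x => Y t x ^+ 2)) by case: (Y2 t).
have iYe := integrable_mulrl (- (2 * e t)) (iY t).
have ie := integrable_cst_prob Pr (e t ^+ 2).
have -> : (\int[Pr]_x (D t x ^+ 2)%:E =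
    \int[Pr]_x (Y t x ^+ 2 + (- (2 * e t) * Y t x + e t ^+ 2))%:E)%E.
  by apply: eq_integral => x _; congr EFin; rewrite /D; ring.
rewrite integral_EFinD//; last exact: integrable_addr.
rewrite integral_EFinD// integral_EFinZ// eE integral_cst_prob.
rewrite -[leRHS]adde0 leeD2l// -EFinM -EFinD lee_fin.
by have := sqr_ge0 (e t); lra.
Qed.

(** All terms with index below [2 ^ n] are bounded through a single variable, so that the double sum
    over [n] and [k] becomes a sum over [n]. *)
Let Y_truncation k n : (k < 2 ^ n)%N ->
  (\int[Pr]_x (Y k x ^+ 2)%:E <=
   \int[Pr]_x (truncation (2 ^+ n) (X 0%N x) ^+ 2)%:E)%E.
Proof.
move=> kn; have mt c : measurable_fun setT (fun z : R => truncation c z ^+ 2).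
  by apply: measurable_funX; exact: measurable_truncation.
rewrite (@law (fun z => truncation k%:R z ^+ 2)) => [|//|z]; last exact: sqr_ge0.
apply: ge0_le_integral => //.
- by move=> x _; rewrite lee_fin sqr_ge0.
- by apply/measurable_EFinP; exact: (measurableT_comp (mt _) (@mX 0%N)).
- by apply/measurable_EFinP; exact: (measurableT_comp (mt _) (@mX 0%N)).
move=> x _; rewrite lee_fin truncation_sqr_mono// -natrX ler_nat ltnW//.
Qed.

(** Sum and expectation are exchanged before estimating: weighted by [2 ^- n], the truncated squares
    of [X 0] sum pathwise to at most twice its modulus, so a first moment is enough. *)
Let D_slln :
  {ae Pr, forall x, cesaro_mean (D ^~ x) @ \oo --> (0 : R)}.
Proof.
apply: (martingale_slln D_orthogonal).
have iN : (\int[Pr]_x `|(X 0%N x)%:E| < +oo)%E by have /integrableP[] := iX.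
apply: (@le_lt_trans _ _ (2%:E * \int[Pr]_x `|(X 0%N x)%:E|)%E); last first.
  by rewrite lte_mul_pinfty// ?lee_fin.
have mt c : measurable_fun setT (fun x => (truncation c (X 0%N x) ^+ 2)%:E).
  apply/measurable_EFinP/measurable_funX.
  exact: (measurableT_comp (measurable_truncation _) (@mX 0%N)).
pose v n x := (2 ^- n * truncation (2 ^+ n) (X 0%N x) ^+ 2)%:E.
have p0 n : 0 <= 2 ^- n :> R by rewrite invr_ge0 exprn_ge0.
have v0 n x : (0 <= v n x)%E by rewrite lee_fin mulr_ge0// sqr_ge0.
have mv n : measurable_fun setT (v n).
  by rewrite /v; under eq_fun do rewrite EFinM; apply: measurable_funeM; exact: mt.
have D20 n : (0 <= \sum_(0 <= k < 2 ^ n) \int[Pr]_x (D k x ^+ 2)%:E)%E.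
  by apply: sume_ge0 => k _; apply: integral_ge0 => x _; rewrite lee_fin sqr_ge0.
apply: (@le_trans _ _ (\sum_(0 <= n <oo) \int[Pr]_x v n x)%E).
  apply: lee_nneseries => [n _ _|n _].
    by rewrite mule_ge0// lee_fin invr_ge0 exprn_ge0.
  rewrite /v; under [leRHS]eq_integral do rewrite EFinM.
  rewrite ge0_integralZl_EFin//; last by move=> x _; rewrite lee_fin sqr_ge0.
  rewrite -quarter_mul_pow2 EFinM -muleA lee_wpmul2l//.
  set I := (\int[Pr]_x _)%E.
  apply: (@le_trans _ _ (\sum_(0 <= k < 2 ^ n) I)%E).
    rewrite big_nat [leRHS]big_nat; apply: lee_sum => k /andP[_ kn].
    by rewrite (le_trans (int_D2 k))// Y_truncation.
  by rewrite sumr_const_nat subn0 mule_natl.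
rewrite -integral_nneseries//.
rewrite -ge0_integralZl_EFin//; last first.
  by apply/measurable_EFinP; exact: measurableT_comp.
apply: ge0_le_integral => //.
- by move=> x _; exact: nneseries_ge0.
- exact: (@ge0_emeasurable_sum _ _ _ _ v xpredT).
- apply: measurable_funeM; apply/measurable_EFinP; exact: measurableT_comp.
move=> x _; apply: nneseries_le => // N.
by rewrite sumEFin lee_fin dyadic_truncation_sum.
Qed.

Let X_eventually_Y :
  {ae Pr, forall x, (fun t => X t x - Y t x) @ \oo --> (0 : R)}.
Proof.
pose a t (z : R) : R := (t%:R < `|z|)%R%:R.
have ma t : measurable_fun setT (a t).
  have -> : a t = fun z => if t%:R < `|z| then 1 else 0.
    by apply/funext => z; rewrite /a; case: (_ < _).
  by apply: measurable_fun_ifT => //; apply: measurable_fun_ltr.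
have a0 t z : 0 <= a t z by rewrite /a ler0n.
have : {ae Pr, forall x, (fun t => a t (X t x)) @ \oo --> (0 : R)}.
  apply: ae_cvg0_summable => //.
    by move=> t; exact: (measurableT_comp (ma t) (@mX t)).
  under eq_eseriesr do rewrite law//.
  have mEa t : measurable_fun setT (fun x => (a t (X 0%N x))%:E).
    by apply/measurable_EFinP; exact: (measurableT_comp (ma t) (@mX 0%N)).
  rewrite -integral_nneseries//; last by move=> t x _; rewrite lee_fin.
  have iN := integrable_addr (integrable_norm iX) (integrable_cst_prob Pr 1).
  have iNoo := integrable_lty measurableT iN.
  apply: le_lt_trans iNoo.
  apply: ge0_le_integral => //.
  - by move=> x _; apply: nneseries_ge0 => t _ _; rewrite lee_fin.
  - apply: (@ge0_emeasurable_sum _ _ _ _ (fun t x => (a t (X 0%N x))%:E) xpredT) => //.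
    by move=> t x _ _; rewrite lee_fin.
  - exact: (measurable_int _ iN).
  move=> x _; apply: nneseries_le => [t|N]; first by rewrite lee_fin.
  by rewrite sumEFin lee_fin tail_indicator_sum.
(* An indicator below 1 is 0, so convergence to 0 makes [X t x] and [Y t x] equal from some index
   on. *)
apply: filterS => x /cvgrPdist_lt /(_ _ ltr01)[N _ HN].
apply: cvg_near_cst; exists N => // t /= Nt.
have := HN t Nt; rewrite sub0r normrN /a /Y /truncation.
by case: (leP `|X t x| t%:R) => _ /=; rewrite ?subrr ?normr1 ?ltxx.
Qed.

Let e_cvg : e @ \oo --> fine (\int[Pr]_x (X 0%N x)%:E)%E.
Proof.
apply: fine_cvg; rewrite fineK; last exact: integrable_fin_num iX.
rewrite (_ : (fun t => _) = fun t => (\int[Pr]_x (truncation t%:R (X 0%N x))%:E)%E).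
  apply: (@dominated_cvg _ _ _ Pr setT measurableT _ _ (fun x => `|X 0%N x|%:E)).
  - by move=> t; apply/measurable_EFinP;
      exact: (measurableT_comp (measurable_truncation _) (@mX 0%N)).
  - move=> x _; apply: cvg_EFin; first exact: nearW.
    exact: truncation_cvg.
  - by [].
  - exact: integrable_norm.
  - by move=> t x _; rewrite lee_fin normr_truncation_le.
apply/funext => t.
have mt0 := measurableT_comp (measurable_truncation t%:R) (@mX 0%N).
have it0 : Pr.-integrable setT (EFin \o (fun x => truncation t%:R (X 0%N x))).
  by apply: (integrable_le mt0 (integrable_norm iX)) => x; exact: normr_truncation_le.
have ft := integrable_cst_prob Pr t%:R.
(* The shift by [t] makes the integrand nonnegative, as [law] requires. *)
have : (\int[Pr]_x (truncation t%:R (X t x) + t%:R)%:E =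
        \int[Pr]_x (truncation t%:R (X 0%N x) + t%:R)%:E)%E.
  apply: (@law (fun z => truncation t%:R z + t%:R)).
    by apply: measurable_funD => //; exact: measurable_truncation.
  move=> z; rewrite -lerBlDr sub0r.
  by have /ler_normlP[] := normr_truncation_bound z (ler0n R t); rewrite lerNl.
rewrite (integral_EFinD (iY t) ft) (integral_EFinD it0 ft) integral_cst_prob.
by move=> /(congr1 (fun z => z - t%:R%:E)%E); rewrite !addeK.
Qed.

Lemma iid_strong_law :
  {ae Pr, forall x, cesaro_mean (X ^~ x) @ \oo --> fine (\int[Pr]_x (X 0%N x)%:E)%E}.
Proof.
have := X_eventually_Y; apply: filterS2 D_slln => x XY D0.
have -> : cesaro_mean (X ^~ x) = fun T => cesaro_mean (fun t => X t x - Y t x) T +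
    (cesaro_mean (D ^~ x) T + cesaro_mean e T).
  apply/funext => T; rewrite -!cesaro_meanD; congr (cesaro_mean _ T).
  by apply/funext => t; rewrite /D; ring.
rewrite -[fine _]add0r -[in X in _ --> X](add0r (fine _)).
apply: cvgD; first exact: cesaro_mean_cvg.
by apply: cvgD => //; exact: cesaro_mean_cvg.
Qed.

End iid_slln.

(** * Measurability of matrix-valued maps *)

Section matrix_measurability.
Context {R : realType}.

Lemma measurable_mx_entry m n (i : 'I_m) (j : 'I_n) :
  measurable_fun [set: 'M[R]_(m, n)] (fun M => M i j).
Proof.
move=> _ B mB; apply: sub_sigma_algebra; exists (i, j) => //.
by exists B.
Qed.

Context {d : measure_display} {T : measurableType d}.

Lemma measurable_mx m n (f : T -> 'M[R]_(m, n)) :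
  (forall i j, measurable_fun setT (fun x => f x i j)) -> measurable_fun setT f.
Proof.
move=> mf; apply: (@measurability _ _ _ _ _ _
  (\bigcup_(ij in [set: 'I_m * 'I_n])
     preimage_set_system setT (fun M : 'M[R]_(m, n) => M ij.1 ij.2) measurable)) => //.
move=> _ [_ [[i j] _ [B mB <-]] <-].
by rewrite !setTI; have := mf i j measurableT B mB; rewrite setTI.
Qed.

Lemma measurable_mx_entryT m n (f : T -> 'M[R]_(m, n)) i j :
  measurable_fun setT f -> measurable_fun setT (fun x => f x i j).
Proof. by move=> mf; exact: (measurableT_comp (measurable_mx_entry i j) mf). Qed.

Lemma measurable_mxD m n (f g : T -> 'M[R]_(m, n)) :
  measurable_fun setT f -> measurable_fun setT g ->
  measurable_fun setT (fun x => f x + g x).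
Proof.
move=> mf mg; apply: measurable_mx => i j; under eq_fun do rewrite mxE.
exact: (measurable_funD (measurable_mx_entryT i j mf) (measurable_mx_entryT i j mg)).
Qed.

Lemma measurable_mxN m n (f : T -> 'M[R]_(m, n)) :
  measurable_fun setT f -> measurable_fun setT (fun x => - f x).
Proof.
move=> mf; apply: measurable_mx => i j; under eq_fun do rewrite mxE.
exact: (measurableT_comp _ (measurable_mx_entryT i j mf)).
Qed.

Lemma measurable_mxM k m n (f : T -> 'M[R]_(k, m)) (g : T -> 'M[R]_(m, n)) :
  measurable_fun setT f -> measurable_fun setT g ->
  measurable_fun setT (fun x => f x *m g x).
Proof.
move=> mf mg; apply: measurable_mx => i j; under eq_fun do rewrite mxE.
apply: measurable_sum => l.
exact: (measurable_funM (measurable_mx_entryT i l mf) (measurable_mx_entryT l j mg)).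
Qed.

Lemma measurable_mulmx k m n (M : 'M[R]_(k, m)) (g : T -> 'M[R]_(m, n)) :
  measurable_fun setT g -> measurable_fun setT (fun x => M *m g x).
Proof. by move=> mg; apply: measurable_mxM. Qed.

Lemma measurable_mx_sum (I : Type) (s : seq I) m n (f : I -> T -> 'M[R]_(m, n)) :
  (forall i, measurable_fun setT (f i)) ->
  measurable_fun setT (fun x => \sum_(i <- s) f i x).
Proof.
move=> mf; elim: s => [|i s IH]; first by under eq_fun do rewrite big_nil; exact: measurable_cst.
under eq_fun do rewrite big_cons.
exact: (measurable_mxD (mf i) IH).
Qed.

Lemma measurable_dot n (f g : T -> 'cV[R]_n) :
  measurable_fun setT f -> measurable_fun setT g ->
  measurable_fun setT (fun x => dot (f x) (g x)).
Proof.
move=> mf mg; under eq_fun do rewrite dotE.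
apply: measurable_sum => a.
exact: (measurable_funM (measurable_mx_entryT a 0 mf) (measurable_mx_entryT a 0 mg)).
Qed.

Lemma measurable_quad n (M : 'M[R]_n) (f : T -> 'cV[R]_n) :
  measurable_fun setT f -> measurable_fun setT (fun x => quad M (f x)).
Proof.
move=> mf; under eq_fun do rewrite quad_dot.
by apply: measurable_dot => //; exact: measurable_mulmx.
Qed.

Lemma measurable_tuple_nth n k l (f : T -> n.-tuple 'M[R]_(k, l)) j :
  measurable_fun setT f -> measurable_fun setT (fun x => nth 0 (f x) j).
Proof.
move=> mf; have [jn|nj] := ltnP j n; last first.
  by under eq_fun do rewrite nth_default ?size_tuple//; exact: measurable_cst.
have -> : (fun x => nth 0 (f x) j) = (@tnth n _ ^~ (Ordinal jn)) \o f.
  by apply/funext => x /=; rewrite (tnth_nth 0).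
exact: (measurableT_comp (measurable_tnth _) mf).
Qed.

End matrix_measurability.

Lemma measurable_preview_feedback (R : realType) (nx nu nw : nat)
  (A : 'M[R]_nx) (Bu : 'M[R]_(nx, nu)) (Bw : 'M[R]_(nx, nw))
  (Ru : 'M[R]_nu) (P : 'M[R]_nx) (p t : nat) :
  measurable_fun setT (@preview_feedback R nx nu nw A Bu Bw Ru P p t).
Proof.
apply: measurable_mxD; last first.
  apply/measurable_mxN/measurable_mulmx/measurable_mx_sum => j.
  by apply/measurable_mulmx/measurable_tuple_nth.
apply: measurable_mxD; first exact/measurable_mxN/measurable_mulmx/measurable_tuple_nth.
exact/measurable_mxN/measurable_mulmx/measurable_tuple_nth.
Qed.

(** * Independence of the past and the noise *)

Section independence_of_pi_system.
Context {d : measure_display} {Omega : measurableType d} {R : realType}.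
Variable Pr : probability Omega R.

(** As functions of [E] both sides are finite measures, [Pr] restricted to [F] and [Pr] scaled by
    [Pr F]; agreement on a pi-system extends to the generated sigma-algebra. *)
Lemma independent_pi_system (G : set (set Omega)) (F : set Omega) :
  G `<=` measurable -> setI_closed G -> G setT -> measurable F ->
  (forall E, G E -> Pr (E `&` F) = Pr E * Pr F)%E ->
  forall E, <<s G >> E -> (Pr (E `&` F) = Pr E * Pr F)%E.
Proof.
move=> Gm GI GT mF GF E GE.
have F0 : 0 <= fine (Pr F) by rewrite fine_ge0.
have PF : Pr F = (fine (Pr F))%:E by rewrite fineK// fin_num_measure.
pose m2 := mscale (NngNum F0) Pr.
have m2E B : m2 B = (Pr B * Pr F)%E.
  by rewrite PF muleC.
rewrite -m2E.
apply: (@g_sigma_algebra_measure_unique _ R _ G Gm (fun=> setT) (fun=> GT) _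
  (mrestr Pr mF) m2 GI _ _ E GE).
- by rewrite bigcup_const//; exists 0%N.
- by move=> B GB; apply: etrans (GF _ GB) (esym (m2E B)).
- move=> _; rewrite /= /mrestr.
  by rewrite (le_lt_trans (probability_le1 _ _)) ?ltry//; exact: measurableI.
Qed.

End independence_of_pi_system.

Section noise_filtration.
Context {d : measure_display} {Omega : measurableType d} {R : realType}.
Variable Pr : probability Omega R.
Context (nx nu nw : nat).
Variables (x0 : Omega -> 'cV[R]_nx) (w : nat -> Omega -> 'cV[R]_nw).
Hypotheses (x0_initial : initial_state Pr x0) (w_iid : iid_noise Pr x0 w).

(** Two separate clocks, [t] for inputs and [n] for disturbances: with preview, inputs reveal later
    disturbances, so [w n] is fresh only for [n] sufficiently ahead of [t]. By contrast [history]
    contains the whole disturbance. *)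
Definition past (u : nat -> Omega -> 'cV[R]_nu) (t n : nat) : set (set Omega) :=
  sigma_of x0 `|` \bigcup_(s in [set s | (s < n)%N]) sigma_of (w s)
  `|` \bigcup_(s in [set s | (s < t)%N]) sigma_of (u s).

Let mx0 : measurable_fun setT x0. Proof. by case: x0_initial. Qed.

Let mw t : measurable_fun setT (w t). Proof. by case: w_iid => + _ _ _ _. Qed.

Lemma sigma_of_measurable d' (T : measurableType d') (X : Omega -> T) :
  measurable_fun setT X -> sigma_of X `<=` measurable.
Proof. by move=> mX _ [B mB <-]; exact: mX. Qed.

Lemma sigma_of_measurable_fun d' (T : measurableType d') (X : Omega -> T)
    (G : set (set Omega)) :
  sigma_of X `<=` G ->
  measurable_fun [set: g_sigma_algebraType G] (X : g_sigma_algebraType G -> T).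
Proof.
by move=> XG _ B mB; apply: sub_sigma_algebra; apply: XG; exists B.
Qed.

Lemma past_measurable u t n : (forall s, measurable_fun setT (u s)) ->
  past u t n `<=` measurable.
Proof.
move=> mu; rewrite /past !subUset; split; first split.
- exact: sigma_of_measurable.
- by apply: bigcup_sub => s _; exact: sigma_of_measurable.
by apply: bigcup_sub => s _; exact: sigma_of_measurable.
Qed.

Lemma past_initial u t n : measurable_fun [set: g_sigma_algebraType (past u t n)]
  (x0 : g_sigma_algebraType (past u t n) -> 'cV[R]_nx).
Proof. by apply: sigma_of_measurable_fun => B HB; left; left. Qed.

Lemma past_noise u t n s : (s < n)%N ->
  measurable_fun [set: g_sigma_algebraType (past u t n)]
    (w s : g_sigma_algebraType (past u t n) -> 'cV[R]_nw).
Proof.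
by move=> sn; apply: sigma_of_measurable_fun => B HB; left; right; exists s.
Qed.

Lemma past_input u t n s : (s < t)%N ->
  measurable_fun [set: g_sigma_algebraType (past u t n)]
    (u s : g_sigma_algebraType (past u t n) -> 'cV[R]_nu).
Proof.
by move=> st; apply: sigma_of_measurable_fun => B HB; right; exists s.
Qed.

Let sigma_ofI d' (T : measurableType d') (X : Omega -> T) E E' :
  sigma_of X E -> sigma_of X E' -> sigma_of X (E `&` E').
Proof.
move=> [B mB <-] [B' mB' <-]; exists (B `&` B'); first exact: measurableI.
by rewrite !setTI.
Qed.

Let sigma_ofT d' (T : measurableType d') (X : Omega -> T) : sigma_of X setT.
Proof. by exists setT => //; rewrite setTI. Qed.

Let family (o : option nat) : set (set Omega) :=
  if o is Some t then sigma_of (w t) else sigma_of x0.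

Let familyI o E E' : family o E -> family o E' -> family o (E `&` E').
Proof. by case: o => [t|]; exact: sigma_ofI. Qed.

Let familyT o : family o setT.
Proof. by case: o => [t|]; exact: sigma_ofT. Qed.

Let family_measurable o : family o `<=` measurable.
Proof. by case: o => [t|]; exact: sigma_of_measurable. Qed.

Lemma past0_independent u n : independent_of Pr (past u 0%N n) (w n).
Proof.
move=> E B pE mB.
pose s := None :: [seq Some i | i <- iota 0 n].
have us : uniq s.
  rewrite /= map_inj_uniq ?iota_uniq ?andbT; last by move=> i j [].
  by apply/mapP => -[].
have ns : Some n \notin s.
  by rewrite in_cons /=; apply/mapP => -[i + [ni]]; rewrite mem_iota -ni ltnn andbF.
(* Each event constrains every generator listed in [s], if only by [setT]: with a fixed index list
   the family is closed under intersection. *)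
pose G : set (set Omega) := [set C | exists2 Ef : option nat -> set Omega,
  (forall o, family o (Ef o)) & C = \bigcap_(o in [set` s]) Ef o].
have Gm : G `<=` measurable.
  move=> _ [Ef fEf ->]; apply: fin_bigcap_measurable; first exact: finite_seq.
  by move=> o _; exact: family_measurable (fEf o).
apply: (@independent_pi_system _ _ _ Pr G) => //.
- move=> _ _ [Ef fEf ->] [Ef' fEf' ->]; exists (fun o => Ef o `&` Ef' o).
    by move=> o; exact: familyI.
  by rewrite bigcapI.
- by exists (fun=> setT) => //; rewrite bigcap_const//; exists None; rewrite /= mem_head.
- by rewrite -[_ @^-1` _]setTI; exact: mw.
- move=> _ [Ef fEf ->].
  have indep := noise_independent w_iid.
  (* The event on [w n] is one more coordinate: mutual independence is used over [Some n :: s] and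
     over [s], and the two products are compared. *)
  pose Ef' o := if o == Some n then w n @^-1` B else Ef o.
  have fEf' o : family o (Ef' o).
    by rewrite /Ef'; case: eqP => // ->; exists B => //; rewrite setTI.
  have EfE o : o \in s -> Ef' o = Ef o.
    by rewrite /Ef'; case: eqP => // -> sn; rewrite sn in ns.
  have nsu : uniq (Some n :: s) by rewrite cons_uniq ns us.
  have := indep (Some n :: s) Ef' nsu (fun o _ => fEf' o).
  rewrite big_cons {2}/Ef' eqxx (indep s Ef us (fun o _ => fEf o)).
  rewrite (eq_big_seq (fun o => Pr (Ef o))); last by move=> o /EfE ->.
  rewrite muleC => <-; congr (Pr _); apply/seteqP; split=> z.
    move=> [Hz Bz] o /=; rewrite in_cons => /orP[/eqP ->|os].
      by rewrite /Ef' eqxx.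
    by rewrite EfE//; exact: Hz.
  move=> Hz; split.
    by move=> o os; rewrite -EfE//; apply: Hz; rewrite /= in_cons os orbT.
  by have := Hz (Some n); rewrite /Ef' eqxx; apply; rewrite /= mem_head.
apply: sub_smallest2r pE; first exact: smallest_sigma_algebra.
have gen o C : o \in s -> family o C -> G C.
  move=> os fC; exists (fun o' => if o' == o then C else setT).
    by move=> o'; case: eqP => // ->.
  apply/seteqP; split=> [z Cz o' _|z /(_ o os)]; first by case: ifP.
  by rewrite eqxx.
rewrite /past !subUset; split; first split.
- by move=> C HC; apply: (gen None) => //; rewrite mem_head.
- move=> C [i /= iN HC]; apply: (gen (Some i)) => //.
  by rewrite in_cons /=; apply/mapP; exists i => //; rewrite mem_iota.
- by move=> C [].
Qed.

End noise_filtration.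

Section closed_loop_filtration.
Context {d : measure_display} {Omega : measurableType d} {R : realType}.
Variable Pr : probability Omega R.
Context (nx nu nw : nat).
Variables (A : 'M[R]_nx) (Bu : 'M[R]_(nx, nu)) (Bw : 'M[R]_(nx, nw)) (p : nat).
Variables (x0 : Omega -> 'cV[R]_nx) (w : nat -> Omega -> 'cV[R]_nw).
Hypotheses (x0_initial : initial_state Pr x0) (w_iid : iid_noise Pr x0 w).
Variables (K : policy_sequence R nx nu nw p).
Variables (x : nat -> Omega -> 'cV[R]_nx) (u : nat -> Omega -> 'cV[R]_nu).
Hypothesis loop : closed_loop Pr A Bu Bw x0 w K x u.

Let mu t : measurable_fun setT (u t).
Proof. by case: loop. Qed.

Let past_m t n : past x0 w u t n `<=` measurable.
Proof. exact: past_measurable x0_initial w_iid _ _ _ mu. Qed.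

Let past_sub t n : <<s past x0 w u t n >> `<=` measurable.
Proof. by apply: smallest_sub => //; exact: sigma_algebra_measurable. Qed.

Lemma past_history t n : <<s past x0 w u t n >> `<=` history x0 w u t.
Proof.
apply: sub_smallest2r; first exact: smallest_sigma_algebra.
move=> E [[HE|[s _ HE]]|HE]; [by left; left|by left; right; exists s|by right].
Qed.

Lemma past_state t n s : (s <= t)%N -> (s <= n)%N ->
  measurable_fun [set: g_sigma_algebraType (past x0 w u t n)]
    (x s : g_sigma_algebraType (past x0 w u t n) -> 'cV[R]_nx).
Proof.
elim: s => [|s IH] st sn; first by rewrite (loop_initial loop); exact: past_initial.
have -> : x s.+1 = fun omega => A *m x s omega + Bu *m u s omega + Bw *m w s omega.
  by apply/funext => omega; rewrite (loop_dynamics loop).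
pose T := g_sigma_algebraType (past x0 w u t n).
have mA := measurable_mulmx A (IH (ltnW st) (ltnW sn)).
have mB := measurable_mulmx Bu (@past_input _ _ _ _ _ _ x0 w u t n s st).
have mW := measurable_mulmx Bw (@past_noise _ _ _ _ _ _ x0 w u t n s sn).
exact: (measurable_mxD (measurable_mxD mA mB) mW).
Qed.

Lemma past_information t n : (t + p < n)%N ->
  measurable_fun [set: g_sigma_algebraType (past x0 w u t n)]
    (information p w x t : g_sigma_algebraType (past x0 w u t n) -> _).
Proof.
move=> tn.
have tn' : (t <= n)%N by rewrite (leq_trans (leq_addr p t))// ltnW.
apply: measurable_fun_pair => /=.
  apply/measurable_fun_tnthP => i.
  rewrite (_ : _ \o _ = x i); last by apply/funext => omega /=; rewrite tnth_mktuple.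
  apply: past_state; first by rewrite -ltnS ltn_ord.
  by rewrite (leq_trans _ tn')// -ltnS ltn_ord.
apply/measurable_fun_tnthP => i.
rewrite (_ : _ \o _ = w i); last by apply/funext => omega /=; rewrite tnth_mktuple.
by apply: past_noise; rewrite (leq_trans (ltn_ord i)).
Qed.

(** Induction on the number of inputs. Given the history, the event that [u t] lies in [B] may be
    replaced by the kernel's value, a function of [i_t]. As [t + p < n] in the inductive step, this
    value is measurable for the past without [u t], and the induction hypothesis applies.
    Randomization thus creates no dependence on [w n]. *)
Lemma past_independent t n : (t + p <= n)%N ->
  independent_of Pr (past x0 w u t n) (w n).
Proof.
elim: t n => [|t IH] n tn; first exact: past0_independent x0_initial w_iid _ _.
move=> E C pE mC.
have tn' : (t + p < n)%N by rewrite -addSn.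
have mw s : measurable_fun setT (w s) by case: w_iid.
set F := w n @^-1` C.
have mF : measurable F by rewrite /F -[_ @^-1` _]setTI; exact: mw.
pose G := [set E' | exists2 E1, <<s past x0 w u t n >> E1 &
  exists2 B, measurable B & E' = E1 `&` u t @^-1` B].
have muB s B : measurable B -> measurable (u s @^-1` B).
  by move=> mB; rewrite -[_ @^-1` _]setTI; exact: mu.
have pT : <<s past x0 w u t n >> setT by exact: (@measurableT _ (g_sigma_algebraType _)).
apply: (@independent_pi_system _ _ _ Pr G) => //.
- move=> _ [E1 /past_sub mE1 [B mB ->]]; apply: measurableI => //; exact: muB.
- move=> _ _ [E1 pE1 [B mB ->]] [E2 pE2 [B' mB' ->]].
  exists (E1 `&` E2); first exact: (@measurableI _ (g_sigma_algebraType (past x0 w u t n))).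
  exists (B `&` B'); first exact: measurableI.
  by rewrite preimage_setI setIACA.
- by exists setT => //; exists setT => //; rewrite preimage_setT setTI.
- move=> _ [E1 pE1 [B mB ->]].
  have mE1 := past_sub pE1.
  have hE1 := past_history pE1.
  (* The whole disturbance belongs to [history], so an event on [w n] may enter the conditioning:
     here [loop_input_law] excludes inputs that exploit disturbances not yet previewed. *)
  have hF : history x0 w u t F.
    by apply: sub_sigma_algebra; left; right; exists n => //; exists C => //; rewrite setTI.
  have hEF : history x0 w u t (E1 `&` F).
    exact: (@measurableI _ (g_sigma_algebraType _) E1 F hE1 hF).
  pose h omega := K t (information p w x t omega) B.
  have mh : measurable_fun [set: g_sigma_algebraType (past x0 w u t n)]
      (h : g_sigma_algebraType (past x0 w u t n) -> \bar R).
    exact: (measurableT_comp (measurable_kernel (K t) B mB) (past_information tn')).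
  have h0 omega : (0 <= h omega)%E by exact: measure_ge0.
  have h1 omega : (h omega <= 1)%E.
    rewrite /h -(prob_kernel (s := K t) (information p w x t omega)).
    by apply: le_measure; rewrite ?inE.
  have hfin omega : h omega \is a fin_num.
    by rewrite ge0_fin_numE// (le_lt_trans (h1 _)) ?ltry.
  pose X omega := fine (h omega) * \1_E1 omega.
  pose Y omega : R := \1_C (w n omega).
  have mX : measurable_fun [set: g_sigma_algebraType (past x0 w u t n)]
      (X : g_sigma_algebraType (past x0 w u t n) -> R).
    apply: (@measurable_funM _ (g_sigma_algebraType (past x0 w u t n))).
      exact: (measurableT_comp (fine_measurable measurableT) mh).
    exact: (@measurable_indic _ (g_sigma_algebraType (past x0 w u t n))).
  have mX' := sub_sigma_measurable_fun (@past_m t n) mX.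
  have m1C : measurable_fun setT (\1_C : _ -> R) by exact: measurable_indic.
  have mY : measurable_fun setT Y by exact: (measurableT_comp m1C (mw n)).
  have ind01 (T' : Type) (S : set T') (z : T') : 0 <= (\1_S z : R) <= 1.
    by rewrite indicE; case: (_ \in _); rewrite /= ?lexx ?ler01.
  have iX : Pr.-integrable setT (EFin \o X).
    apply: (integrable_le mX' (integrable_cst_prob Pr 1)) => omega.
    have /andP[i0 i1] := ind01 _ E1 omega.
    rewrite ger0_norm ?mulr_ge0 ?fine_ge0// mulr_ile1 ?fine_ge0//.
    by rewrite -lee_fin fineK.
  have iY : Pr.-integrable setT (EFin \o Y).
    apply: (integrable_le mY (integrable_cst_prob Pr 1)) => omega.
    by have /andP[i0 i1] := ind01 _ C (w n omega); rewrite ger0_norm.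
  have XY := @integral_indepM _ _ _ Pr X Y mX' mY
    (past_noise_product (IH n (ltnW tn')) mX m1C) iX iY.
  rewrite setIAC (loop_input_law loop hEF mB) (loop_input_law loop hE1 mB).
  have -> : (\int[Pr]_(omega in E1 `&` F) h omega = \int[Pr]_omega (X omega * Y omega)%:E)%E.
    rewrite integral_mkcond; apply: eq_integral => omega _.
    rewrite patchE /X /Y !indicE in_setI (_ : (w n omega \in C) = (omega \in F)); last first.
      by apply/idP/idP; rewrite !inE.
    by do 2!case: (_ \in _); rewrite /= ?mulr1 ?mulr0 ?fineK.
  have -> : (\int[Pr]_(omega in E1) h omega = \int[Pr]_omega (X omega)%:E)%E.
    rewrite integral_mkcond; apply: eq_integral => omega _.
    by rewrite patchE /X !indicE; case: (_ \in _); rewrite /= ?mulr1 ?mulr0 ?fineK.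
  rewrite XY; congr (_ * _)%E.
  rewrite (_ : (fun _ => _) = EFin \o \1_F); last first.
    by apply/funext => omega; rewrite /Y /= !indicE; congr (_%:R%:E); apply/idP/idP; rewrite !inE.
  by rewrite integral_indic// setIT.
apply: sub_smallest2r pE; first exact: smallest_sigma_algebra.
have pG C' : <<s past x0 w u t n >> C' -> G C'.
  by move=> pC; exists C' => //; exists setT => //; rewrite preimage_setT setIT.
rewrite {1}/past !subUset; split; first split.
- by move=> C' HC; apply: pG; apply: sub_sigma_algebra; left; left.
- by move=> C' HC; apply: pG; apply: sub_sigma_algebra; left; right.
- move=> C' [s /=]; rewrite ltnS leq_eqVlt => /orP[/eqP ->|st] HC.
    by case: HC => B mB <-; exists setT => //; exists B.
  by apply: pG; apply: sub_sigma_algebra; right; exists s.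
Qed.

End closed_loop_filtration.

(** * Cesaro limits along trajectories *)

Section cesaro_limits.
Context {R : realType}.

Lemma cvg_invn : (fun n : nat => n%:R^-1) @ \oo --> (0 : R).
Proof. by rewrite -cvg_shiftS; exact: cvg_harmonic. Qed.

(** The last term is an increment of the partial sums, hence [f T / T] is asymptotically a
    difference of consecutive means. It turns a strong law for energies into almost sure growth
    slower than [T], at no cost in moments. *)
Lemma cesaro_mean_last (f : nat -> R) (c : R) :
  cesaro_mean f @ \oo --> c -> (fun T => T%:R^-1 * f T) @ \oo --> (0 : R).
Proof.
move=> fc; rewrite -cvg_shiftS /=.
have f1 : (fun T => cesaro_mean f T.+1) @ \oo --> c by rewrite cvg_shiftS.
have f2 : (fun T => cesaro_mean f T.+2) @ \oo --> c.
  by have := f1; rewrite -(cvg_shiftS (fun T => cesaro_mean f T.+1)).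
have i1 : (fun n : nat => n.+1%:R^-1) @ \oo --> (0 : R) by exact: cvg_harmonic.
have -> : (fun n : nat => n.+1%:R^-1 * f n.+1) =
    fun n => cesaro_mean f n.+2 + n.+1%:R^-1 * cesaro_mean f n.+2 - cesaro_mean f n.+1.
  apply/funext => n; rewrite /cesaro_mean [in X in _ = X](@big_nat_recr _ _ _ n.+1)//=.
  have n1 : n.+1%:R != 0 :> R by rewrite pnatr_eq0.
  have n2 : n.+2%:R != 0 :> R by rewrite pnatr_eq0.
  rewrite -(natr1 n.+1) in n2 *.
  move: n.+1%:R (\sum_(_ <= _ < _) _) (f n.+1) n1 n2 => k S y k0 k1.
  by field; rewrite k1 k0.
suff : (fun n => cesaro_mean f n.+2 + n.+1%:R^-1 * cesaro_mean f n.+2 -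
    cesaro_mean f n.+1) @ \oo --> c + 0 * c - c by rewrite mul0r addr0 subrr.
by apply: cvgB => //; apply: cvgD => //; exact: cvgM.
Qed.

Lemma leaky_sum_sublinear (r q0 : R) (e : nat -> R) :
  0 <= r < 1 -> 0 <= q0 -> (forall s, 0 <= e s) ->
  (fun T => T%:R^-1 * e T) @ \oo --> (0 : R) ->
  (fun T => T%:R^-1 * leaky_sum r q0 e T) @ \oo --> (0 : R).
Proof.
move=> r01 q00 e0 eT; have /andP[r0 r1] := r01.
have r1' : 0 < 1 - r by rewrite subr_gt0.
apply/cvgrPdist_lt => eps eps0.
(* Chosen so that [dl / (1 - r) = eps / 2]; the constant [c] below absorbs the finitely many early
   terms. *)
pose dl : R := eps * (1 - r) / 2.
have dl0 : 0 < dl by rewrite divr_gt0// mulr_gt0.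
have /cvgrPdist_lt/(_ _ dl0)[N _ HN] := eT.
pose c := \sum_(0 <= s < N.+1) e s.
have c0 : 0 <= c by exact: sumr_ge0.
have ele s : e s <= dl * s%:R + c.
  have [sN|Ns] := ltnP s N.+1.
    have esc : e s <= c.
      by rewrite /c big_mkord (bigD1 (Ordinal sN))//= lerDl sumr_ge0.
    by rewrite (le_trans esc)// lerDr mulr_ge0// ltW.
  have s0 : 0 < s%:R :> R by rewrite ltr0n (leq_trans _ Ns).
  have := HN s (ltnW Ns); rewrite sub0r normrN => /(le_lt_trans (ler_norm _)).
  by rewrite mulrC ltr_pdivrMr// => /ltW; move=> /le_trans; apply; rewrite lerDl.
have bound T : T%:R^-1 * leaky_sum r q0 e T <=
    eps / 2 + T%:R^-1 * (q0 + c / (1 - r)).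
  case: T => [|T]; first by rewrite invr0 !mul0r addr0 ltW// divr_gt0.
  have T0 : T.+1%:R != 0 :> R by rewrite pnatr_eq0.
  rewrite (_ : _ + _ = T.+1%:R^-1 * (q0 + (dl * T.+1%:R + c) / (1 - r))).
    by rewrite ler_wpM2l ?invr_ge0// leaky_sum_linear_growth// ltW.
  rewrite /dl; move: (T.+1%:R : R) T0 => k k0; field.
  by rewrite k0 subr_eq0 eq_sym lt_eqF.
have tail : (fun T : nat => T%:R^-1 * (q0 + c / (1 - r))) @ \oo --> (0 : R).
  suff : (fun T : nat => T%:R^-1 * (q0 + c / (1 - r))) @ \oo -->
      0 * (q0 + c / (1 - r)) by rewrite mul0r.
  by apply: cvgM; [exact: cvg_invn|exact: cvg_cst].
have e2 : 0 < eps / 2 by rewrite divr_gt0.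
have /cvgrPdist_lt/(_ _ e2)[M _ HM] := tail.
exists M => // T /= MT; rewrite sub0r normrN ger0_norm; last first.
  by rewrite mulr_ge0 ?invr_ge0// leaky_sum_ge0.
apply: (le_lt_trans (bound T)); rewrite [ltRHS](splitr eps) ltrD2l.
have := HM T MT; rewrite sub0r normrN; apply: le_lt_trans; exact: ler_norm.
Qed.

(** A lower bound for a limsup needs only a subsequence, and [k < 2 ^ k] lets this one reach every
    tail. *)
Lemma limn_esup_ge (a b : nat -> R) (c : R) :
  (forall k, b k <= a (2 ^ k)%N) -> b @ \oo --> c ->
  (c%:E <= limn_esup (EFin \o a))%E.
Proof.
move=> ba bc; rewrite limn_esup_lim; apply: lime_ge; first exact: is_cvg_esups.
apply: nearW => m.
have bc' : (EFin \o b) @ \oo --> c%:E by apply: cvg_EFin; [exact: nearW|].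
rewrite -(cvg_lim _ bc')//; apply: lime_le; first by apply/cvg_ex; exists c%:E.
exists m => // k /= mk; apply: (@le_trans _ _ (a (2 ^ k)%N)%:E).
  by rewrite lee_fin.
apply: ereal_sup_ubound; exists (2 ^ k)%N => //=.
by rewrite (leq_trans mk)// ltnW// ltn_expl.
Qed.

End cesaro_limits.

Definition cesaro_limit {d : measure_display} {Omega : measurableType d}
    {R : realType} (Pr : probability Omega R) (f : nat -> Omega -> R) (c : R) : Prop :=
  {ae Pr, forall omega, cesaro_mean (f ^~ omega) @ \oo --> c}.

Section cesaro_limit.
Context {d : measure_display} {Omega : measurableType d} {R : realType}.
Variable Pr : probability Omega R.
Implicit Types f g : nat -> Omega -> R.

Lemma cesaro_limitD f g a b : cesaro_limit Pr f a -> cesaro_limit Pr g b ->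
  cesaro_limit Pr (fun t omega => f t omega + g t omega) (a + b).
Proof.
move=> fa gb; apply: filterS2 fa gb => omega fa gb.
rewrite (_ : cesaro_mean _ = fun T => cesaro_mean (f ^~ omega) T + cesaro_mean (g ^~ omega) T).
  exact: cvgD.
by apply/funext => T; rewrite cesaro_meanD.
Qed.

Lemma cesaro_limitZ k f a : cesaro_limit Pr f a ->
  cesaro_limit Pr (fun t omega => k * f t omega) (k * a).
Proof.
move=> fa; apply: filterS fa => omega fa.
rewrite (_ : cesaro_mean _ = fun T => k * cesaro_mean (f ^~ omega) T).
  by apply: cvgM => //; exact: cvg_cst.
by apply/funext => T; rewrite cesaro_meanZ.
Qed.

Lemma cesaro_limit_sum (I : Type) (s : seq I) (f : I -> nat -> Omega -> R) (c : I -> R) :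
  (forall i, cesaro_limit Pr (f i) (c i)) ->
  cesaro_limit Pr (fun t omega => \sum_(i <- s) f i t omega) (\sum_(i <- s) c i).
Proof.
move=> fc; elim: s => [|i s IH].
  rewrite big_nil; apply: aeW => omega; apply: cesaro_mean_cvg.
  by under eq_fun do rewrite big_nil; exact: cvg_cst.
rewrite big_cons (_ : (fun _ _ => _) =
    fun t omega => f i t omega + \sum_(i <- s) f i t omega).
  exact: cesaro_limitD.
by apply/funext => t; apply/funext => omega; rewrite big_cons.
Qed.

End cesaro_limit.

(** * Moving averages of the noise and their quadratic forms *)

Section noise_processes.
Context {d : measure_display} {Omega : measurableType d} {R : realType}.
Variable Pr : probability Omega R.
Context (nx nw : nat).
Variables (x0 : Omega -> 'cV[R]_nx) (w : nat -> Omega -> 'cV[R]_nw).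
Hypotheses (x0_initial : initial_state Pr x0) (w_iid : iid_noise Pr x0 w).

Lemma noise_entry_measurable t a : measurable_fun setT (fun omega => w t omega a 0).
Proof. by apply: measurable_mx_entryT; case: w_iid. Qed.

Lemma integral_noise_sqr t a : (\int[Pr]_omega (w t omega a 0 ^+ 2)%:E = 1)%E.
Proof.
have := noise_covariance w_iid t t a a; rewrite !eqxx /= unlock => <-.
by apply: eq_integral => omega _; rewrite expr2.
Qed.

Lemma noise_sq_integrable t a : sq_integrable Pr (fun omega => w t omega a 0).
Proof.
have mw := noise_entry_measurable t a; split=> //.
apply: (@integrable_of_bound _ _ _ _ _ 1%E).
- exact: measurable_funX.
- by move=> omega; rewrite sqr_ge0.
- by rewrite integral_noise_sqr.
- exact: ltry.
Qed.

Lemma integral_noise t a : (\int[Pr]_omega (w t omega a 0)%:E = 0)%E.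
Proof. by have := noise_mean w_iid t a; rewrite unlock. Qed.

(** A zero-dimensional input, so that the filtration is that of [x0] and the noise, free of any
    policy. *)
Let no_input : nat -> Omega -> 'cV[R]_0 := fun _ _ => 0.

Let P0 := past x0 w no_input 0.

Let P0m n : P0 n `<=` measurable.
Proof.
have mu s : measurable_fun setT (no_input s) by exact: measurable_cst.
exact: (@past_measurable _ _ _ Pr _ _ _ x0 w x0_initial w_iid no_input 0%N n mu).
Qed.

Let P0_noise n s a : (s < n)%N ->
  measurable_fun [set: g_sigma_algebraType (P0 n)]
    ((fun omega => w s omega a 0) : g_sigma_algebraType (P0 n) -> R).
Proof.
move=> sn; have := @past_noise _ _ _ _ _ _ x0 w no_input 0%N n s sn.
exact: measurable_mx_entryT.
Qed.

Let noise_same_time i a b :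
  exists c, cesaro_limit Pr (fun t omega => w (t + i)%N omega a 0 * w (t + i)%N omega b 0) c.
Proof.
pose g (z : 'cV[R]_nw) := z a 0 * z b 0.
have mg : measurable_fun setT g.
  exact: (measurable_funM (measurable_mx_entry a 0) (measurable_mx_entry b 0)).
eexists; apply: (@iid_strong_law _ _ _ Pr (fun n => P0 (n + i)%N)
  (fun t omega => w (t + i)%N omega a 0 * w (t + i)%N omega b 0)).
- by move=> n; exact: P0m.
- by move=> n; exact: (measurable_funM (noise_entry_measurable _ _) (noise_entry_measurable _ _)).
- move=> k n kn; apply: (@measurable_funM _ (g_sigma_algebraType (P0 (n + i)%N))).
    by apply: P0_noise; rewrite ltn_add2r.
  by apply: P0_noise; rewrite ltn_add2r.
- move=> n; apply: (independent_of_comp mg).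
  exact: past0_independent x0_initial w_iid _ _.
- move=> s t B mB; apply: (noise_identically_distributed w_iid (s + i) (t + i) (B := g @^-1` B)).
  by rewrite -[_ @^-1` _]setTI; exact: mg.
- exact: sq_integrable_integrableM (noise_sq_integrable _ _) (noise_sq_integrable _ _).
Qed.

Let noise_later i j a b : (i < j)%N ->
  exists c, cesaro_limit Pr (fun t omega => w (t + i)%N omega a 0 * w (t + j)%N omega b 0) c.
Proof.
move=> ij; exists 0.
have mb : measurable_fun setT (fun z : 'cV[R]_nw => z b 0) by exact: measurable_mx_entry.
have Fm n : P0 (n + j)%N `<=` measurable by exact: P0m.
have Ym n : measurable_fun [set: g_sigma_algebraType (P0 (n + j)%N)]
    ((fun omega => w (n + i)%N omega a 0) : g_sigma_algebraType (P0 (n + j)%N) -> R).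
  by apply: P0_noise; rewrite ltn_add2l.
have mw n : measurable_fun setT (w n) by case: w_iid.
have FW n : independent_of Pr (P0 (n + j)%N) (w (n + j)%N).
  exact: past0_independent x0_initial w_iid _ _.
(* The filtration is shifted by [j], which makes the later factor the fresh one and the earlier
   factor predictable. *)
apply: (@martingale_slln_bounded _ _ _ Pr (fun n => P0 (n + j)%N) _ 1).
  apply: (@orthogonal_to_past_product _ _ _ Pr _ _ (fun n => P0 (n + j)%N)
    (fun n omega => w (n + i)%N omega a 0) (fun n => w (n + j)%N) (fun _ z => z b 0)) => //.
  - by move=> n; exact: noise_sq_integrable.
  - by move=> n; exact: noise_sq_integrable.
  - by move=> n; exact: integral_noise.
  - move=> k n kn; apply: (@measurable_funM _ (g_sigma_algebraType (P0 (n + j)%N))).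
      by apply: P0_noise; rewrite -addnS leq_add// ltnW.
    by apply: P0_noise; rewrite ltn_add2r.
move=> n; rewrite (@integral_product_sqr _ _ _ Pr _ _ (fun n => P0 (n + j)%N)
    (fun n omega => w (n + i)%N omega a 0) (fun n => w (n + j)%N) (fun _ z => z b 0)) //.
- by rewrite !integral_noise_sqr mule1.
- by move=> k; exact: noise_sq_integrable.
- by move=> k; exact: noise_sq_integrable.
Qed.

Lemma noise_product_cesaro i j a b :
  exists c, cesaro_limit Pr (fun t omega => w (t + i)%N omega a 0 * w (t + j)%N omega b 0) c.
Proof.
have [ij|ji|<-] := ltngtP i j; [exact: noise_later| |exact: noise_same_time].
rewrite (_ : (fun _ _ => _) = fun t omega => w (t + j)%N omega b 0 * w (t + i)%N omega a 0).
  exact: noise_later.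
by apply/funext => t; apply/funext => omega; rewrite mulrC.
Qed.

(** The window starts at [t] and has fixed length, so quadratic forms in such processes expand into
    finitely many products of noise entries with fixed lags. *)
Definition moving_average (p n : nat) (y : nat -> Omega -> 'cV[R]_n) : Prop :=
  exists N : nat -> 'M[R]_(n, nw), forall t omega,
    y t omega = \sum_(0 <= j < p.+1) N j *m w (t + j)%N omega.

Lemma moving_averageD p n (y z : nat -> Omega -> 'cV[R]_n) :
  moving_average p y -> moving_average p z ->
  moving_average p (fun t omega => y t omega + z t omega).
Proof.
move=> [N NE] [N' NE']; exists (fun j => N j + N' j) => t omega.
by rewrite NE NE' -big_split; apply: eq_bigr => j _; rewrite mulmxDl.
Qed.

Lemma moving_average_mulmx p m n (M : 'M[R]_(m, n)) (y : nat -> Omega -> 'cV[R]_n) :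
  moving_average p y -> moving_average p (fun t omega => M *m y t omega).
Proof.
move=> [N NE]; exists (fun j => M *m N j) => t omega.
by rewrite NE mulmx_sumr; apply: eq_bigr => j _; rewrite mulmxA.
Qed.

Lemma moving_average_noise p n (M : 'M[R]_(n, nw)) j : (j <= p)%N ->
  moving_average p (fun t omega => M *m w (t + j)%N omega).
Proof.
move=> jp; exists (fun i => if i == j then M else 0) => t omega.
rewrite big_mkord (bigD1 (Ordinal (jp : (j < p.+1)%N)))//= eqxx big1 ?addr0// => i ij.
by rewrite (_ : _ == _ = false) ?mul0mx//; apply/negbTE.
Qed.

Lemma moving_average_sum p n (I : Type) (s : seq I) (y : I -> nat -> Omega -> 'cV[R]_n) :
  (forall i, moving_average p (y i)) ->
  moving_average p (fun t omega => \sum_(i <- s) y i t omega).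
Proof.
move=> /choice[N NE]; exists (fun j => \sum_(i <- s) N i j) => t omega.
under eq_bigr do rewrite NE; rewrite exchange_big /=.
by apply: eq_bigr => j _; rewrite mulmx_suml.
Qed.

Lemma moving_average_dot_cesaro p n (y z : nat -> Omega -> 'cV[R]_n) :
  moving_average p y -> moving_average p z ->
  exists c, cesaro_limit Pr (fun t omega => dot (y t omega) (z t omega)) c.
Proof.
move=> [N NE] [N' NE'].
rewrite (_ : (fun _ _ => _) = fun t omega => \sum_a \sum_(0 <= j < p.+1) \sum_b
    \sum_(0 <= j' < p.+1) \sum_b' (N j a b * N' j' a b') *
      (w (t + j)%N omega b 0 * w (t + j')%N omega b' 0)).
  have /choice[c cE] : forall q : nat * nat * 'I_nw * 'I_nw, exists c, cesaro_limit Pr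
      (fun t omega => w (t + q.1.1.1)%N omega q.1.2 0 * w (t + q.1.1.2)%N omega q.2 0) c.
    by move=> q; exact: noise_product_cesaro.
  eexists; apply: cesaro_limit_sum => a; apply: cesaro_limit_sum => j.
  apply: cesaro_limit_sum => b; apply: cesaro_limit_sum => j'.
  by apply: cesaro_limit_sum => b'; apply: cesaro_limitZ; exact: (cE (j, j', b, b')).
apply/funext => t; apply/funext => omega; rewrite dotE; apply: eq_bigr => a _.
rewrite NE NE' !summxE mulr_suml; apply: eq_bigr => j _.
rewrite mxE mulr_suml; apply: eq_bigr => b _.
rewrite mulr_sumr; apply: eq_bigr => j' _.
rewrite mxE mulr_sumr; apply: eq_bigr => b' _.
ring.
Qed.

Lemma moving_average_measurable p n (y : nat -> Omega -> 'cV[R]_n) t :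
  moving_average p y -> measurable_fun setT (y t).
Proof.
move=> [N NE]; rewrite (_ : y t = fun omega => \sum_(0 <= j < p.+1) N j *m w (t + j)%N omega).
  by apply: measurable_mx_sum => j; apply: measurable_mulmx; case: w_iid.
by apply/funext => omega; rewrite NE.
Qed.

Lemma integral_noise_dot t : (\int[Pr]_omega (dot (w t omega) (w t omega))%:E = nw%:R%:E)%E.
Proof.
under eq_integral do rewrite dot_sqr.
rewrite integral_EFin_sum; last by move=> a; case: (noise_sq_integrable t a).
under eq_bigr do rewrite integral_noise_sqr.
by rewrite sumEFin sumr_const card_ord.
Qed.

(** Induction on the window length gives a bound uniform in [t]; each added term costs the factor 2
    of [dotD_le]. *)
Lemma moving_average_energy p n (y : nat -> Omega -> 'cV[R]_n) : moving_average p y ->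
  exists2 b : R, 0 <= b &
    forall t, (\int[Pr]_omega (dot (y t omega) (y t omega))%:E <= b%:E)%E.
Proof.
move=> [N NE]; have mw t : measurable_fun setT (w t) by case: w_iid.
suff [b b0 yb] : exists2 b : R, 0 <= b & forall t, (\int[Pr]_omega
    (dot (\sum_(0 <= j < p.+1) N j *m w (t + j)%N omega)
         (\sum_(0 <= j < p.+1) N j *m w (t + j)%N omega))%:E <= b%:E)%E.
  by exists b => // t; under eq_integral do rewrite NE; exact: yb.
elim: p.+1 => [|q [b b0 IH]].
  exists 0 => // t; rewrite integral0_eq// => omega _.
  by rewrite big_geq// dotE big1// => a _; rewrite mxE mul0r.
have [C C0 NC] := dot_mulmx_le (N q).
exists (2 * (b + C * nw%:R)); first by rewrite mulr_ge0// addr_ge0// mulr_ge0.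
move=> t; pose s omega := \sum_(0 <= j < q) N j *m w (t + j)%N omega.
have ms : measurable_fun setT s by apply: measurable_mx_sum => j; exact: measurable_mulmx.
have mz : measurable_fun setT (w (t + q)%N) by [].
apply: (@le_trans _ _ (\int[Pr]_omega (2%:E * ((dot (s omega) (s omega))%:E +
    C%:E * (dot (w (t + q)%N omega) (w (t + q)%N omega))%:E)))%E).
  apply: ge0_le_integral => //.
  - by move=> omega _; rewrite lee_fin dot_ge0.
  - apply/measurable_EFinP; under eq_fun do rewrite big_nat_recr//=.
    have mD := measurable_mxD ms (measurable_mulmx (N q) mz).
    exact: (measurable_dot mD mD).
  - apply/measurable_EFinP; apply: measurable_funM => //; apply: measurable_funD.
      exact: measurable_dot.
    by apply: measurable_funM => //; exact: measurable_dot.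
  - move=> omega _; rewrite -EFinM lee_fin big_nat_recr//=.
    by rewrite (le_trans (dotD_le _ _))// ler_wpM2l// lerD2l.
have dot0 (v : Omega -> 'cV[R]_n) omega : (0 <= (dot (v omega) (v omega))%:E)%E.
  by rewrite lee_fin dot_ge0.
have wdot0 omega : (0 <= (dot (w (t + q)%N omega) (w (t + q)%N omega))%:E)%E.
  by rewrite lee_fin dot_ge0.
have msd := measurable_dot ms ms; have mzd := measurable_dot mz mz.
rewrite ge0_integralZl_EFin//; last 2 first.
- by move=> omega _; rewrite adde_ge0// mule_ge0.
- by apply/measurable_EFinP; apply: measurable_funD => //; exact: measurable_funM.
rewrite EFinM lee_wpmul2l// ge0_integralD//; last 3 first.
- exact/measurable_EFinP.
- by move=> omega _; rewrite mule_ge0.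
- by apply/measurable_EFinP; exact: measurable_funM.
rewrite ge0_integralZl_EFin//; last exact/measurable_EFinP/mzd.
by rewrite integral_noise_dot EFinD EFinM leeD2r// IH.
Qed.

End noise_processes.

(** * Costs of stabilizing policies and of the preview feedback *)

Section preview_lqr.
Context {d : measure_display} {Omega : measurableType d} {R : realType}.
Variable Pr : probability Omega R.
Context (nx nu nw p : nat).
Variables (A : 'M[R]_nx) (Bu : 'M[R]_(nx, nu)) (Bw : 'M[R]_(nx, nw)).
Variables (Q : 'M[R]_nx) (Ru : 'M[R]_nu) (P : 'M[R]_nx).
Variables (x0 : Omega -> 'cV[R]_nx) (w : nat -> Omega -> 'cV[R]_nw).
Hypotheses (x0_initial : initial_state Pr x0) (w_iid : iid_noise Pr x0 w).
Hypothesis P_solution : stabilizing_solution A Bu Q Ru P.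

Let drift t omega := Bw *m w t omega.
Let preview t omega := preview_sum A Bu Ru P Bw p (w ^~ omega) t.
Let forcing t omega := forcing_cost Bu Ru P (drift t omega) (preview t.+1 omega).
Let last_gain := preview_gain A Bu Ru P Bw p.+1.

Let drift_ma : moving_average w p drift.
Proof.
have := @moving_average_noise _ _ _ _ w p _ Bw 0%N (leq0n p).
rewrite (_ : (fun _ _ => _) = drift)//.
by apply/funext => t; apply/funext => omega; rewrite /drift addn0.
Qed.

(** The cases [k = 0] and [k = 1] give [v_t] and [v_(t+1)]; both fit in the window from [t] to
    [t + p]. *)
Let preview_ma k : (k <= 1)%N -> moving_average w p (fun t => preview (t + k)%N).
Proof.
move=> k1; have := @moving_average_sum _ _ _ _ w p _ _ (index_enum 'I_p)
  (fun j t omega => preview_gain A Bu Ru P Bw j.+1 *m w (t + (k + j))%N omega).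
rewrite (_ : (fun t omega => \sum_(i <- _) _) = fun t => preview (t + k)%N).
  apply=> j; apply: moving_average_noise.
  by rewrite (@leq_trans (1 + j))// leq_add2r.
apply/funext => t; apply/funext => omega.
by apply: eq_bigr => j _; rewrite addnA.
Qed.

Let next_preview_ma : moving_average w p (fun t => preview t.+1).
Proof.
by have := preview_ma (leqnn 1); under [X in moving_average _ _ X]eq_fun do rewrite addn1.
Qed.

Let preview0_ma : moving_average w p preview.
Proof.
have := preview_ma (leq0n 1); rewrite (_ : (fun t => preview (t + 0)%N) = preview)//.
by apply/funext => t; rewrite addn0.
Qed.

Lemma forcing_cesaro : exists c, cesaro_limit Pr forcing c.
Proof.
have bma := moving_average_mulmx Bu^T
  (moving_averageD (moving_average_mulmx P drift_ma) next_preview_ma).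
have := moving_average_dot_cesaro x0_initial w_iid bma
  (moving_average_mulmx (invmx (riccati_H Bu Ru P)) bma).
have := moving_average_dot_cesaro x0_initial w_iid drift_ma next_preview_ma.
have := moving_average_dot_cesaro x0_initial w_iid drift_ma (moving_average_mulmx P drift_ma).
move=> [c1 f1] [c2 /(cesaro_limitZ 2) f2] [c3 /(cesaro_limitZ (-1)) f3].
exists (c1 + 2 * c2 + -1 * c3).
have := cesaro_limitD (cesaro_limitD f1 f2) f3.
rewrite (_ : (fun _ _ => _) = forcing)//.
by apply/funext => t; apply/funext => omega; rewrite /forcing /forcing_cost mulN1r.
Qed.

Let preview_energy_small :
  {ae Pr, forall omega,
    (fun T => T%:R^-1 * dot (preview T omega) (preview T omega)) @ \oo --> (0 : R)}.
Proof.
have [c] := moving_average_dot_cesaro x0_initial w_iid preview0_ma preview0_ma.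
by apply: filterS => omega /cesaro_mean_last.
Qed.

Let boundary (x : nat -> Omega -> 'cV[R]_nx) t omega :=
  quad P (x t omega) + 2 * dot (x t omega) (preview t omega).

Let boundary_le : exists2 C : R, 0 <= C & forall x t omega,
  `|boundary x t omega| <= C * dot (x t omega) (x t omega) +
    2 * dot (preview t omega) (preview t omega).
Proof.
have [C C0 PC] := dot_mulmx_le P; exists (1 + C + 2); first by rewrite !addr_ge0.
move=> x t omega; rewrite /boundary quad_dot (le_trans (ler_normD _ _))//.
rewrite normrM ger0_norm//.
have := normr_dot_le (x t omega) (P *m x t omega).
have := normr_dot_le (x t omega) (preview t omega).
have := PC (x t omega).
move: (dot (x t omega) (x t omega)) (dot (P *m _) _) (dot (preview _ _) (preview _ _)) => a b e.
move: `|_| `|_| => y z; lra.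
Qed.

(** The times [tau] are left free: powers of 2 for a competing policy, all times for the optimal
    one. *)
Let boundary_small (x : nat -> Omega -> 'cV[R]_nx) omega (tau : nat -> nat) :
  (fun k => (tau k)%:R^-1 * dot (x (tau k) omega) (x (tau k) omega)) @ \oo --> (0 : R) ->
  (fun k => (tau k)%:R^-1 *
     dot (preview (tau k) omega) (preview (tau k) omega)) @ \oo --> (0 : R) ->
  (fun k => (tau k)%:R^-1 * boundary x (tau k) omega) @ \oo --> (0 : R).
Proof.
move=> x0' v0; have [C C0 bC] := boundary_le.
pose e k := C * ((tau k)%:R^-1 * dot (x (tau k) omega) (x (tau k) omega)) +
  2 * ((tau k)%:R^-1 * dot (preview (tau k) omega) (preview (tau k) omega)).
have e0 : e @ \oo --> (0 : R).
  suff : e @ \oo --> C * 0 + 2 * 0 by rewrite !mulr0 addr0.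
  by apply: cvgD; apply: cvgM => //; exact: cvg_cst.
apply: norm_cvg0; apply: (@squeeze_cvgr _ _ _ _ (fun=> 0) e) => //; last exact: cvg_cst.
apply: nearW => k; rewrite normr_ge0/= normrM ger0_norm ?invr_ge0//.
by rewrite /e !(mulrCA _ (_^-1)) -mulrDr ler_wpM2l// invr_ge0.
Qed.

Section closed_loop_cost.
Variables (K : policy_sequence R nx nu nw p).
Variables (x : nat -> Omega -> 'cV[R]_nx) (u : nat -> Omega -> 'cV[R]_nu).
Hypothesis loop : closed_loop Pr A Bu Bw x0 w K x u.

Lemma loop_input_measurableT t : measurable_fun setT (u t).
Proof. by case: loop. Qed.

Lemma loop_state_measurable t : measurable_fun setT (x t).
Proof.
have mw s : measurable_fun setT (w s) by case: w_iid.
elim: t => [|t IH]; first by rewrite (loop_initial loop); case: x0_initial.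
rewrite (_ : x t.+1 = fun omega => A *m x t omega + Bu *m u t omega + Bw *m w t omega).
  exact: (measurable_mxD (measurable_mxD (measurable_mulmx A IH)
    (measurable_mulmx Bu (loop_input_measurableT t))) (measurable_mulmx Bw (mw t))).
by apply/funext => omega; rewrite (loop_dynamics loop).
Qed.

Let mx := loop_state_measurable.

Lemma average_costE omega T :
  average_cost Q Ru x u T omega =
  T%:R^-1 * boundary x 0%N omega - T%:R^-1 * boundary x T omega
  + cesaro_mean (fun t => quad (riccati_H Bu Ru P) (u t omega -
      optimal_input A Bu Ru P (x t omega) (drift t omega) (preview t.+1 omega))) T
  + (cesaro_mean (forcing ^~ omega) T
  + 2 * cesaro_mean (fun t => dot (x t omega) (last_gain *m w (t + p)%N omega)) T).
Proof.
rewrite /average_cost (cost_completion P_solution (Bw := Bw) p (xi := w ^~ omega)); last first.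
  by move=> t; rewrite (loop_dynamics loop).
rewrite big_split /= -mulr_sumr /cesaro_mean.
have split (a X Y S F C : R) : a * (X - Y + S + (F + 2 * C)) =
    a * X - a * Y + a * S + (a * F + 2 * (a * C)) by ring.
exact: split.
Qed.

Hypothesis x_stable : stabilizing Pr x.

Let x_energy : exists2 M : R, 0 <= M & forall t,
  (\int[Pr]_omega (dot (x t omega) (x t omega))%:E <= M%:E)%E.
Proof.
have [M HM] := x_stable; exists M; last first.
  by move=> t; have [_] := HM t; rewrite /second_moment unlock.
have [_ HM0] := HM 0%N; rewrite -lee_fin (le_trans _ HM0)//.
rewrite /second_moment unlock; apply: integral_ge0 => omega _.
by rewrite lee_fin; exact: dot_ge0.
Qed.

Let state_entry_energy : exists2 M : R, 0 <= M & forall t a,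
  (\int[Pr]_omega (x t omega a 0%R ^+ 2)%:E <= M%:E)%E.
Proof.
have [M M0 xM] := x_energy; exists M => // t a.
apply: le_trans (xM t); apply: ge0_le_integral => //.
- by move=> omega _; rewrite lee_fin sqr_ge0.
- by apply/measurable_EFinP/measurable_funX/measurable_mx_entryT.
- by apply/measurable_EFinP; exact: measurable_dot.
- by move=> omega _; rewrite lee_fin sqr_le_dot.
Qed.

Let state_noise_small a b :
  cesaro_limit Pr (fun t omega => x t omega a 0 * w (t + p)%N omega b 0) 0.
Proof.
have [M M0 xM] := state_entry_energy.
have mu := loop_input_measurableT.
have mw s : measurable_fun setT (w s) by case: w_iid.
(* Rich enough to contain [x n], whose inputs stop before [n], and still independent of
   [w (n + p)]. *)
pose F n := past x0 w u n (n + p).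
have Fm n : F n `<=` measurable by exact: (past_measurable x0_initial w_iid mu).
have Fx k n : (k <= n)%N -> measurable_fun [set: g_sigma_algebraType (F n)]
    ((fun omega => x k omega a 0) : g_sigma_algebraType (F n) -> R).
  move=> kn; apply: measurable_mx_entryT; apply: (past_state loop) => //.
  by rewrite (leq_trans kn)// leq_addr.
have x2 n : sq_integrable Pr (fun omega => x n omega a 0).
  have mxa := measurable_mx_entryT a 0 (mx n); split=> //.
  apply: (integrable_of_bound _ _ (xM n a)); last exact: ltry.
    exact: measurable_funX.
  by move=> omega; rewrite sqr_ge0.
have w2 n : sq_integrable Pr ((fun z : 'cV[R]_nw => z b 0) \o w (n + p)%N).
  exact: noise_sq_integrable w_iid _ _.
have FW n : independent_of Pr (F n) (w (n + p)%N).
  exact: (past_independent x0_initial w_iid loop (leqnn (n + p)%N)).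
have mb : measurable_fun setT (fun z : 'cV[R]_nw => z b 0) by exact: measurable_mx_entry.
apply: (@martingale_slln_bounded _ _ _ Pr F _ M).
  apply: (@orthogonal_to_past_product _ _ _ Pr _ _ F (fun n omega => x n omega a 0)
    (fun n => w (n + p)%N) (fun _ z => z b 0)) => //.
  - by move=> n; exact: Fx.
  - by move=> n; exact: (integral_noise w_iid).
  - move=> k n kn; apply: (@measurable_funM _ (g_sigma_algebraType (F n))).
      by apply: Fx; exact: ltnW.
    apply: measurable_mx_entryT; apply: past_noise; by rewrite ltn_add2r.
move=> n; rewrite (@integral_product_sqr _ _ _ Pr _ _ F (fun n omega => x n omega a 0)
    (fun n => w (n + p)%N) (fun _ z => z b 0)) //; last by move=> k; exact: Fx.
by rewrite (integral_noise_sqr w_iid) mule1.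
Qed.

Lemma state_noise_cross_cesaro :
  cesaro_limit Pr (fun t omega => dot (x t omega) (last_gain *m w (t + p)%N omega)) 0.
Proof.
rewrite (_ : (fun _ _ => _) = fun t omega => \sum_a \sum_b last_gain a b *
    (x t omega a 0 * w (t + p)%N omega b 0)).
  have zero : \sum_(a < nx) \sum_(b < nw) last_gain a b * 0 = 0.
    by rewrite big1// => a _; rewrite big1// => b _; rewrite mulr0.
  rewrite -[X in cesaro_limit _ _ X]zero.
  apply: cesaro_limit_sum => a; apply: cesaro_limit_sum => b.
  by apply: cesaro_limitZ; exact: state_noise_small.
apply/funext => t; apply/funext => omega; rewrite dotE; apply: eq_bigr => a _.
by rewrite mxE mulr_sumr; apply: eq_bigr => b _; rewrite mulrCA.
Qed.

Let pow2_cvg : (fun k : nat => (2 ^ k)%N) @ \oo --> \oo.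
Proof.
move=> S [N _ NS]; exists N => // k /= Nk; apply: NS => /=.
by rewrite (leq_trans Nk)// ltnW// ltn_expl.
Qed.

Let state_dyadic_small :
  {ae Pr, forall omega, (fun k => (2 ^ k)%N%:R^-1 *
     dot (x (2 ^ k)%N omega) (x (2 ^ k)%N omega)) @ \oo --> (0 : R)}.
Proof.
have [M M0 xM] := x_energy.
have mdx t : measurable_fun setT (fun omega => dot (x t omega) (x t omega)).
  exact: measurable_dot.
apply: ae_cvg0_summable.
- by move=> k; apply: measurable_funM => //; exact: mdx.
- by move=> k omega; rewrite mulr_ge0 ?invr_ge0 ?dot_ge0.
apply: le_lt_trans (half_powers_cvg M0); apply: lee_nneseries => [k _ _|k _].
  by apply: integral_ge0 => omega _; rewrite lee_fin mulr_ge0 ?invr_ge0 ?dot_ge0.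
under eq_integral do rewrite EFinM.
rewrite ge0_integralZl_EFin//.
- by rewrite EFinM natrX lee_wpmul2l// lee_fin invr_ge0 exprn_ge0.
- by move=> omega _; rewrite lee_fin dot_ge0.
- exact/measurable_EFinP/mdx.
Qed.

Lemma cost_lower_bound c : cesaro_limit Pr forcing c ->
  {ae Pr, forall omega, (c%:E <= cost_infty Q Ru x u omega)%E}.
Proof.
move=> forcing_c.
apply: filterS (filterI (filterI preview_energy_small forcing_c)
  (filterI state_noise_cross_cesaro state_dyadic_small)) => omega [[v0 fc] [cr0 xd0]].
pose b k := (2 ^ k)%N%:R^-1 * boundary x 0%N omega
  - (2 ^ k)%N%:R^-1 * boundary x (2 ^ k)%N omega
  + (cesaro_mean (forcing ^~ omega) (2 ^ k)%N
  + 2 * cesaro_mean (fun t => dot (x t omega) (last_gain *m w (t + p)%N omega)) (2 ^ k)%N).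
apply: (@limn_esup_ge _ (fun T => average_cost Q Ru x u T omega) b) => [k|].
  (* Dropping the nonnegative squares in [H] is the only inequality; it becomes an equality under
     the optimal input. *)
  rewrite average_costE /b lerD2r lerDl /cesaro_mean mulr_ge0 ?invr_ge0//.
  by apply: sumr_ge0 => t _; apply: pd_quad_ge0; case: P_solution.
have bnd : (fun k => (2 ^ k)%N%:R^-1 * boundary x (2 ^ k)%N omega) @ \oo --> (0 : R).
  by apply: boundary_small => //; exact: (cvg_comp _ _ pow2_cvg v0).
suff : b @ \oo --> 0 * boundary x 0%N omega - 0 + (c + 2 * 0).
  by rewrite mul0r subr0 mulr0 add0r addr0.
apply: cvgD; [apply: cvgB => //; apply: cvgM|apply: cvgD].
- exact: (cvg_comp _ _ pow2_cvg cvg_invn).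
- exact: cvg_cst.
- exact: (cvg_comp _ _ pow2_cvg fc).
- by apply: cvgM; [exact: cvg_cst|exact: (cvg_comp _ _ pow2_cvg cr0)].
Qed.

End closed_loop_cost.

Section optimal_loop.
Variables (K : policy_sequence R nx nu nw p).
Variables (x : nat -> Omega -> 'cV[R]_nx) (u : nat -> Omega -> 'cV[R]_nu).
Hypothesis loop : closed_loop Pr A Bu Bw x0 w K x u.
Hypothesis u_optimal : {ae Pr, forall omega, forall t,
  u t omega = optimal_input A Bu Ru P (x t omega) (drift t omega) (preview t.+1 omega)}.

Let b t omega := Bu^T *m (P *m drift t omega + preview t.+1 omega).

(** What drives the state under the optimal input: substitution gives
    [x_(t+1) = Ahat x_t + eta_t]. *)
Let eta t omega := drift t omega + (- Bu *m invmx (riccati_H Bu Ru P)) *m b t omega.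

Let eta_ma : moving_average w p eta.
Proof.
have bma := moving_average_mulmx Bu^T
  (moving_averageD (moving_average_mulmx P drift_ma) next_preview_ma).
exact: (moving_averageD drift_ma (moving_average_mulmx _ bma)).
Qed.

Let mx t : measurable_fun setT (x t).
Proof. exact: (loop_state_measurable loop). Qed.

Let optimal_energy : exists C r : R, [/\ 0 <= C, 0 <= r < 1 &
  {ae Pr, forall omega, forall t, dot (x t omega) (x t omega) <=
    C * leaky_sum r (dot (x0 omega) (x0 omega))
      (fun t => dot (eta t omega) (eta t omega)) t}].
Proof.
have [_ _ _ Acl_schur] := P_solution.
have [C [r [C0 r01 HC]]] := schur_energy Acl_schur.
exists C, r; split=> //; apply: filterS u_optimal => omega uE t.
rewrite -(loop_initial loop); apply: (HC (x ^~ omega) (eta ^~ omega)) => {}t.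
rewrite (loop_dynamics loop) uE /optimal_input /closed_loop_matrix /eta -/(b t omega).
rewrite mulmxBr mulmxN mulmxBl !mulNmx mulmxA -[Bu *m invmx _ *m _]mulmxA.
rewrite -!addrA; congr (_ + _); rewrite mulmxA; congr (_ + _).
by rewrite addrC.
Qed.

Lemma optimal_stabilizing : stabilizing Pr x.
Proof.
have [C [r [C0 r01 xC]]] := optimal_energy; have /andP[r0 r1] := r01.
have r1' : 0 < 1 - r by rewrite subr_gt0.
have [e e0 etaE] := moving_average_energy w_iid eta_ma.
have mx0 : measurable_fun setT x0 by case: x0_initial.
have meta t := moving_average_measurable w_iid t eta_ma.
have md t := measurable_dot (meta t) (meta t).
have [m0 m00 x0E] : exists2 m0 : R, 0 <= m0 &
    (\int[Pr]_omega (dot (x0 omega) (x0 omega))%:E <= m0%:E)%E.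
  have [_] := x0_initial; rewrite /second_moment unlock => x0oo.
  have x00 : (0 <= \int[Pr]_omega (dot (x0 omega) (x0 omega))%:E)%E.
    by apply: integral_ge0 => omega _; rewrite lee_fin dot_ge0.
  exists (fine (\int[Pr]_omega (dot (x0 omega) (x0 omega))%:E)%E); first exact: fine_ge0.
  by rewrite fineK// ge0_fin_numE.
pose q t omega := leaky_sum r (dot (x0 omega) (x0 omega))
  (fun t => dot (eta t omega) (eta t omega)) t.
have q0 t omega : 0 <= q t omega.
  by apply: leaky_sum_ge0 => // [|s]; exact: dot_ge0.
have mq t : measurable_fun setT (q t).
  elim: t => [|t IH]; first exact: measurable_dot.
  by apply: measurable_funD => //; exact: measurable_funM.
(* Large enough for both the initial energy and the recursion, since [r * B + e <= B]. *)
pose B := m0 + e / (1 - r).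
have B0 : 0 <= B by rewrite addr_ge0// divr_ge0// ltW.
have qB t : (\int[Pr]_omega (q t omega)%:E <= B%:E)%E.
  elim: t => [|t IH].
    by rewrite (le_trans x0E)// lee_fin /B lerDl divr_ge0// ltW.
  rewrite /q /= -/(q t _); under eq_integral do rewrite EFinD EFinM.
  rewrite ge0_integralD//; last 4 first.
  - by move=> omega _; apply: mule_ge0; rewrite lee_fin//; exact: q0.
  - by apply/measurable_EFinP; apply: measurable_funM => //; exact: mq.
  - by move=> omega _; rewrite lee_fin dot_ge0.
  - exact/measurable_EFinP/md.
  have qe0 omega : (0 <= (q t omega)%:E)%E by rewrite lee_fin.
  rewrite (ge0_integralZl_EFin _ _ (fun omega _ => qe0 omega) _ r0)//;
    last exact/measurable_EFinP/mq.
  apply: (@le_trans _ _ (r%:E * B%:E + e%:E)%E).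
    by apply: leeD => //; rewrite lee_wpmul2l.
  rewrite -EFinM -EFinD lee_fin.
  have -> : r * B + e = B - (1 - r) * m0.
    by rewrite /B; field; rewrite subr_eq0 eq_sym lt_eqF.
  by rewrite gerBl mulr_ge0// ltW.
have x2 t : (\int[Pr]_omega (dot (x t omega) (x t omega))%:E <= (C * B)%:E)%E.
  apply: (@le_trans _ _ (\int[Pr]_omega (C%:E * (q t omega)%:E))%E).
    apply: ae_ge0_le_integral => //.
    - by move=> omega _; rewrite lee_fin dot_ge0.
    - by apply/measurable_EFinP; exact: measurable_dot.
    - by move=> omega _; apply: mule_ge0; rewrite lee_fin.
    - by apply/measurable_EFinP; exact: measurable_funM.
    - by apply: filterS xC => omega xC _; rewrite -EFinM lee_fin.
  have qe0 omega : (0 <= (q t omega)%:E)%E by rewrite lee_fin.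
  rewrite (ge0_integralZl_EFin _ _ (fun omega _ => qe0 omega) _ C0)//;
    last exact/measurable_EFinP/mq.
  by rewrite EFinM lee_wpmul2l.
(* The 1 serves the mean, through [|y| <= 1 + y ^ 2]. *)
exists (1 + C * B) => t; split; last first.
  rewrite /second_moment unlock (le_trans (x2 t))// lee_fin.
  by rewrite lerDr.
move=> a; rewrite unlock.
have mxa := measurable_mx_entryT a 0 (mx t).
apply: (@le_trans _ _ (\int[Pr]_omega `|(x t omega a 0%R)%:E|)%E).
  by apply: le_abse_integral => //; exact/measurable_EFinP.
apply: (@le_trans _ _ (\int[Pr]_omega (1 + dot (x t omega) (x t omega))%:E)%E).
  apply: ge0_le_integral => //.
  - by apply/measurable_EFinP; exact: measurableT_comp.
  - apply/measurable_EFinP; apply: measurable_funD => //; exact: measurable_dot.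
  - move=> omega _; rewrite lee_fin.
    apply: (@le_trans _ _ (1 + x t omega a 0 ^+ 2)); last by rewrite lerD2l sqr_le_dot.
    rewrite -(real_normK (num_real (x t omega a 0))).
    by move: `|_| => y; have := sqr_ge0 (y - 1); nra.
under eq_integral do rewrite EFinD.
rewrite ge0_integralD//; last 2 first.
- by move=> omega _; rewrite lee_fin dot_ge0.
- by apply/measurable_EFinP; exact: measurable_dot.
by rewrite integral_cst_prob EFinD leeD2l.
Qed.

Lemma optimal_cost_limit c : cesaro_limit Pr forcing c ->
  {ae Pr, forall omega, (fun T => average_cost Q Ru x u T omega) @ \oo --> c}.
Proof.
move=> forcing_c.
have [C [r [C0 r01 xC]]] := optimal_energy.
have [ce eta_ce] := moving_average_dot_cesaro x0_initial w_iid eta_ma eta_ma.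
apply: filterS (filterI (filterI preview_energy_small (filterI forcing_c u_optimal))
  (filterI (state_noise_cross_cesaro loop optimal_stabilizing) (filterI xC eta_ce)))
  => omega [[v0 [fc uE]] [cr0 [{}xC etac]]].
(* The strong law for the energy of [eta] makes its last term negligible against [T], and the leaky
   sum passes this on to the state at every time, not only at sparse ones. *)
have lk0 := leaky_sum_sublinear r01 (dot_ge0 (x0 omega))
  (fun t => dot_ge0 (eta t omega)) (cesaro_mean_last etac).
have xs : (fun T => T%:R^-1 * dot (x T omega) (x T omega)) @ \oo --> (0 : R).
  apply: (@squeeze_cvgr _ _ _ _ (fun=> 0) (fun T => C * (T%:R^-1 *
    leaky_sum r (dot (x0 omega) (x0 omega)) (fun t => dot (eta t omega) (eta t omega)) T))).
  - apply: nearW => T; rewrite mulr_ge0 ?invr_ge0 ?dot_ge0//=.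
    by rewrite mulrCA ler_wpM2l ?invr_ge0.
  - exact: cvg_cst.
  - rewrite -[X in _ --> X](mulr0 C); apply: cvgM => //; exact: cvg_cst.
rewrite (_ : (fun T => _) = fun T => T%:R^-1 * boundary x 0%N omega
  - T%:R^-1 * boundary x T omega + (cesaro_mean (forcing ^~ omega) T
  + 2 * cesaro_mean (fun t => dot (x t omega) (last_gain *m w (t + p)%N omega)) T)).
  suff : (fun T => T%:R^-1 * boundary x 0%N omega
      - T%:R^-1 * boundary x T omega + (cesaro_mean (forcing ^~ omega) T
      + 2 * cesaro_mean (fun t => dot (x t omega) (last_gain *m w (t + p)%N omega)) T))
    @ \oo --> 0 * boundary x 0%N omega - 0 + (c + 2 * 0).
    by rewrite mul0r subr0 mulr0 add0r addr0.
  apply: cvgD; [apply: cvgB => //; first apply: cvgM|apply: cvgD => //].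
  - exact: cvg_invn.
  - exact: cvg_cst.
  - exact: (boundary_small xs v0).
  - by apply: cvgM => //; exact: cvg_cst.
apply/funext => T; rewrite (average_costE loop) [X in _ + X + _](_ : _ = 0) ?addr0//.
rewrite /cesaro_mean big1 ?mulr0// => t _.
by rewrite uE subrr quad_dot mulmx0 dotE big1// => a _; rewrite mxE mul0r.
Qed.

End optimal_loop.
End preview_lqr.

(** * Conditional expectations and optimality *)

Section conditional_expectation.
Context {d : measure_display} {Omega : measurableType d} {R : realType}.
Variable Pr : probability Omega R.

(** Stated for signed [f] and [a], as a version of a conditional expectation is not known to be
    nonnegative; the sign of [a] decides which part of [f] is estimated. *)
Lemma integral_le_cst (D : set Omega) (f : Omega -> \bar R) (a : R) :
  measurable D -> measurable_fun D f -> (forall x, D x -> (f x <= a%:E)%E) ->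
  (\int[Pr]_(x in D) f x <= a%:E * Pr D)%E.
Proof.
move=> mD mf fa; rewrite integralE.
have [a0|a0] := leP 0 a.
  apply: (@le_trans _ _ (\int[Pr]_(x in D) f^\+ x)%E).
    by rewrite -[leRHS]sube0 leeB// integral_ge0.
  rewrite -(integral_cst Pr mD a%:E); apply: ge0_le_integral => //.
    exact: measurable_funepos.
  by move=> x Dx; rewrite funeposE ge_max fa//= lee_fin.
have f0 x : D x -> (f x <= 0)%E by move=> /fa /le_trans; apply; rewrite lee_fin ltW.
rewrite [X in (X - _)%E](_ : _ = 0%E) ?sub0e; last first.
  by apply: integral0_eq => x Dx; rewrite funeposE max_r// f0.
rewrite leeNl -mulNe -EFinN -(integral_cst Pr mD (- a)%:E).
apply: ge0_le_integral => //.
- by move=> x _; rewrite lee_fin oppr_ge0 ltW.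
- exact: measurable_funeneg.
- by move=> x Dx; rewrite funenegE le_max EFinN leeN2 fa.
Qed.

(** Where [v] falls short of [c] by at least [n.+1%:R^-1], comparing the integrals of [J] and [v]
    forces probability zero; countably many such events exhaust the exceptional set. *)
Lemma cond_expectation_ge {d'} {T : measurableType d'} (Z : Omega -> T)
    (J : Omega -> \bar R) (v : T -> \bar R) (c : R) :
  measurable_fun setT Z -> measurable_fun setT J -> (forall x, (0 <= J x)%E) ->
  {ae Pr, forall x, (c%:E <= J x)%E} -> is_cond_expectation Pr Z J v ->
  {ae Pr, forall x, (c%:E <= v (Z x))%E}.
Proof.
move=> mZ mJ J0 cJ [mv vJ].
pose B n := [set z : T | (v z <= (c - n.+1%:R^-1)%:E)%E].
have mB n : measurable (B n).
  have := emeasurable_fun_infty_c measurableT mv (c - n.+1%:R^-1)%:E.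
  by rewrite setTI.
have PB n : Pr (Z @^-1` B n) = 0%E.
  set D := Z @^-1` B n.
  have mD : measurable D by rewrite /D -[_ @^-1` _]setTI; exact: mZ.
  have mvZ : measurable_fun D (v \o Z).
    by apply: measurable_funTS; exact: measurableT_comp.
  have up : (\int[Pr]_(x in D) (v \o Z) x <= (c - n.+1%:R^-1)%:E * Pr D)%E.
    by apply: integral_le_cst.
  have low : (c%:E * Pr D <= \int[Pr]_(x in D) J x)%E.
    have [c0|c0] := leP 0 c.
      rewrite -(integral_cst Pr mD c%:E); apply: ae_ge0_le_integral => //.
        exact: measurable_funTS.
      by apply: filterS cJ => x cJ _.
    apply: (@le_trans _ _ 0%E); last by apply: integral_ge0.
    by rewrite mule_le0_ge0// lee_fin ltW.
  rewrite (vJ _ (mB n)) in low.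
  have := le_trans low up.
  have PD : Pr D = (fine (Pr D))%:E by rewrite fineK// fin_num_measure.
  have f0 : 0 <= fine (Pr D) by rewrite fine_ge0.
  rewrite PD -!EFinM lee_fin mulrBl -[leLHS]addr0 lerD2l oppr_ge0.
  rewrite pmulr_rle0 ?invr_gt0 ?ltr0n// => fle.
  by congr EFin; apply/eqP; rewrite eq_le fle.
have : {ae Pr, forall x, forall n, ~ (Z @^-1` B n) x}.
  apply/ae_foralln => n; exists (Z @^-1` B n); split.
  - by rewrite -[_ @^-1` _]setTI; exact: mZ.
  - exact: PB.
  - by move=> x /= /contrapT.
apply: filterS => x nB; apply/lee_addgt0Pr => e e0.
have [n ne] : exists n : nat, n.+1%:R^-1 < e.
  have [n] := ltr_add_invr (e0 : 0 < e); rewrite add0r => ne; by exists n.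
rewrite leNgt; apply/negP => vlt; apply: (nB n); rewrite /B /=.
apply: ltW; apply: lt_le_trans (_ : (c - e)%:E <= _)%E; last by rewrite lee_fin lerD2l lerN2 ltW.
by rewrite EFinB lteBrDr.
Qed.

End conditional_expectation.

Section feedback_on_information.
Context {d : measure_display} {Omega : measurableType d} {R : realType}.
Context (nx nu nw p : nat).
Variables (A : 'M[R]_nx) (Bu : 'M[R]_(nx, nu)) (Bw : 'M[R]_(nx, nw)).
Variables (Ru : 'M[R]_nu) (P : 'M[R]_nx).

Lemma preview_feedbackE (w : nat -> Omega -> 'cV[R]_nw) (x : nat -> Omega -> 'cV[R]_nx) t omega :
  preview_feedback A Bu Bw Ru P (information p w x t omega) =
  optimal_input A Bu Ru P (x t omega) (Bw *m w t omega)
    (preview_sum A Bu Ru P Bw p (w ^~ omega) t.+1).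
Proof.
have nw2 j : (j < (t + p).+1)%N -> nth 0 (information p w x t omega).2 j = w j omega.
  by move=> jt; rewrite (nth_mktuple _ _ (Ordinal jt)).
have nx1 : nth 0 (information p w x t omega).1 t = x t omega.
  by rewrite (nth_mktuple _ _ (Ordinal (ltnSn t))).
rewrite /preview_feedback nx1 nw2; last by rewrite ltnS leq_addr.
have -> : preview_term A Bu Bw Ru P (information p w x t omega) =
    preview_sum A Bu Ru P Bw p (w ^~ omega) t.+1.
  transitivity (\sum_(t.+1 <= j < (t + p).+1)
      preview_gain A Bu Ru P Bw (j - t) *m w j omega).
    by apply: eq_big_nat => j /andP[_ jt]; rewrite nw2.
  rewrite -addSn -[X in \sum_(X <= _ < _) _]add0n [(t.+1 + p)%N]addnC.
  rewrite big_addn addnK big_mkord; apply: eq_bigr => j _.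
  by rewrite [in X in preview_gain _ _ _ _ _ X]addnS -addSn addnK addnC.
rewrite /optimal_input !mulmxDr opprD addrA /gain_w /gain_v.
by rewrite !mulmxA.
Qed.

End feedback_on_information.

Section deterministic_feedback.
Context {d : measure_display} {Omega : measurableType d} {R : realType}.
Variable Pr : probability Omega R.
Context (nx nu nw p : nat).
Variables (A : 'M[R]_nx) (Bu : 'M[R]_(nx, nu)) (Bw : 'M[R]_(nx, nw)).
Variables (x0 : Omega -> 'cV[R]_nx) (w : nat -> Omega -> 'cV[R]_nw).
Hypotheses (x0_initial : initial_state Pr x0) (w_iid : iid_noise Pr x0 w).

Section feedback_loop.
Variable k : forall t, info R nx nw p t -> 'cV[R]_nu.
Variable mk : forall t, measurable_fun setT (@k t).
Variables (x : nat -> Omega -> 'cV[R]_nx) (u : nat -> Omega -> 'cV[R]_nu).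
Hypothesis loop : closed_loop Pr A Bu Bw x0 w (fun t => kdirac (@mk t)) x u.

Let fb t omega := k (information p w x t omega).

(** Over the event that [fb t] lies in [C], the input law integrates Dirac masses at points of [C],
    which give [B] no weight. *)
Let input_null t (C B : set 'cV[R]_nu) : measurable C -> measurable B ->
  B `&` C = set0 -> {ae Pr, forall omega, ~ (C (fb t omega) /\ B (u t omega))}.
Proof.
move=> mC mB BC0.
have pC : <<s past x0 w u t (t + p).+1 >> (fb t @^-1` C).
  have mfb : measurable_fun [set: g_sigma_algebraType (past x0 w u t (t + p).+1)]
      (fb t : g_sigma_algebraType (past x0 w u t (t + p).+1) -> 'cV[R]_nu).
    exact: (measurableT_comp (@mk t) (past_information loop (ltnSn (t + p)))).
  by have := mfb measurableT C mC; rewrite setTI.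
have mu : measurable_fun setT (u t) by case: loop.
have muB : measurable (u t @^-1` B) by rewrite -[_ @^-1` _]setTI; exact: mu.
have mfC : measurable (fb t @^-1` C).
  have mpast := past_measurable x0_initial w_iid (fun s => loop_input_measurable loop s).
  by apply: smallest_sub pC; [exact: sigma_algebra_measurable|exact: mpast].
exists (fb t @^-1` C `&` u t @^-1` B); split; first exact: measurableI.
  rewrite (loop_input_law loop (past_history pC) mB).
  apply: integral0_eq => omega /= Cfb; rewrite /kdirac diracE memNset// => Bfb.
  by have : (B `&` C) (fb t omega) by []; rewrite BC0.
by move=> omega /= /contrapT.
Qed.

(** A Dirac kernel prescribes only a conditional law, whereas the cost analysis needs the input
    itself. Half-spaces with rational thresholds separate distinct vectors; they are countably many,
    and each separating event is null. *)
Lemma kdirac_input_eq :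
  {ae Pr, forall omega, forall t, u t omega = k (information p w x t omega)}.
Proof.
apply/ae_foralln => t.
pose below (a : 'I_nu) (q : rat) : set 'cV[R]_nu := [set z | z a 0 < ratr q].
pose above (a : 'I_nu) (q : rat) : set 'cV[R]_nu := [set z | ratr q <= z a 0].
have mbelow a q : measurable (below a q).
  rewrite (_ : below a q = setT `&` (fun z : 'cV[R]_nu => z a 0) @^-1` `]-oo, ratr q[).
    by apply: measurable_mx_entry => //; exact: measurable_itv.
  by rewrite setTI; apply/seteqP; split=> z; rewrite /below /= in_itv.
have mabove a q : measurable (above a q).
  rewrite (_ : above a q = ~` below a q); first exact: measurableC.
  by apply/seteqP; split=> z; rewrite /above /below /= leNgt => /negP.
have disj a q : below a q `&` above a q = set0.
  by apply/seteqP; split=> // z []; rewrite /below /above /= ltNge => /negP.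
(* Pairs of a coordinate and a rational are enumerated by [unpickle], so that the almost sure events
   can be intersected. *)
have sep : {ae Pr, forall omega, forall n, if unpickle n is Some (a, q) then
    ~ (above a q (fb t omega) /\ below a q (u t omega)) /\
    ~ (below a q (fb t omega) /\ above a q (u t omega)) else True}.
  apply/ae_foralln => n; case: unpickle => [[a q]|]; last exact: aeW.
  have h1 : {ae Pr, forall omega, ~ (above a q (fb t omega) /\ below a q (u t omega))}.
    by apply: input_null => //; exact: disj.
  have h2 : {ae Pr, forall omega, ~ (below a q (fb t omega) /\ above a q (u t omega))}.
    by apply: input_null => //; rewrite setIC.
  by apply: filterS2 h1 h2 => omega.
apply: filterS sep => omega sep; apply/colP => a.
have {}sep q : ~ (above a q (fb t omega) /\ below a q (u t omega)) /\
    ~ (below a q (fb t omega) /\ above a q (u t omega)).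
  by have := sep (pickle (a, q)); rewrite pickleK.
rewrite -/(fb t omega); apply/eqP; rewrite eq_le !leNgt.
apply/andP; split; apply/negP => /rat_in_itvoo[q]; rewrite in_itv/= => /andP[l r].
  by have [_] := sep q; apply; rewrite /below /above /= l ltW.
by have [+ _] := sep q; apply; rewrite /below /above /= l ltW.
Qed.

End feedback_loop.

End deterministic_feedback.

Section optimality.
Context {d : measure_display} {Omega : measurableType d} {R : realType}.
Variable Pr : probability Omega R.
Context (nx nu nw p : nat).
Variables (A : 'M[R]_nx) (Bu : 'M[R]_(nx, nu)) (Bw : 'M[R]_(nx, nw)).
Variables (Q : 'M[R]_nx) (Ru : 'M[R]_nu) (P : 'M[R]_nx).
Variables (x0 : Omega -> 'cV[R]_nx) (w : nat -> Omega -> 'cV[R]_nw).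
Hypotheses (x0_initial : initial_state Pr x0) (w_iid : iid_noise Pr x0 w).

Let mw t : measurable_fun setT (w t). Proof. by case: w_iid. Qed.

Let mx0 : measurable_fun setT x0. Proof. by case: x0_initial. Qed.

Lemma measurable_information (x : nat -> Omega -> 'cV[R]_nx) t :
  (forall s, (s <= t)%N -> measurable_fun setT (x s)) ->
  measurable_fun setT (information p w x t).
Proof.
move=> mx; apply: measurable_fun_pair => /=; apply/measurable_fun_tnthP => i.
  rewrite (_ : _ \o _ = x i); first by apply: mx; rewrite -ltnS.
  by apply/funext => omega /=; rewrite tnth_mktuple.
by rewrite (_ : _ \o _ = w i)//; apply/funext => omega /=; rewrite tnth_mktuple.
Qed.

Lemma measurable_cost_infty (x : nat -> Omega -> 'cV[R]_nx) (u : nat -> Omega -> 'cV[R]_nu) :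
  (forall t, measurable_fun setT (x t)) -> (forall t, measurable_fun setT (u t)) ->
  measurable_fun setT (cost_infty Q Ru x u).
Proof.
move=> mx mu; apply: (@measurable_fun_limn_esup _ _ _ _
  (fun T omega => (average_cost Q Ru x u T omega)%:E)) => T.
apply/measurable_EFinP; apply: measurable_funM => //; apply: measurable_sum => t.
by apply: measurable_funD; apply: measurable_quad.
Qed.

Lemma cost_infty_ge0 (x : nat -> Omega -> 'cV[R]_nx) (u : nat -> Omega -> 'cV[R]_nu) omega :
  psd Q -> pd Ru -> (0 <= cost_infty Q Ru x u omega)%E.
Proof.
move=> [_ Q0] Rpd; apply: (@limn_esup_ge _ (fun T => average_cost Q Ru x u T omega)
  (fun=> 0)); last exact: cvg_cst.
move=> k; rewrite mulr_ge0 ?invr_ge0// sumr_ge0// => t _.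
by rewrite addr_ge0 ?Q0 ?pd_quad_ge0.
Qed.

(** The recursion goes through [optimal_input], which reads the current state only, and not through
    [preview_feedback], whose argument collects all states so far; [preview_feedbackE] reconciles
    the two. *)
Fixpoint optimal_state (t : nat) (omega : Omega) : 'cV[R]_nx :=
  if t is s.+1 then
    A *m optimal_state s omega
    + Bu *m optimal_input A Bu Ru P (optimal_state s omega) (Bw *m w s omega)
        (preview_sum A Bu Ru P Bw p (w ^~ omega) t)
    + Bw *m w s omega
  else x0 omega.

Lemma preview_feedback_loop
    (mk : forall t, measurable_fun setT (@preview_feedback R nx nu nw A Bu Bw Ru P p t)) :
  exists x u, closed_loop Pr A Bu Bw x0 w (fun t => kdirac (mk t)) x u.
Proof.
pose u t omega := preview_feedback A Bu Bw Ru P (information p w optimal_state t omega).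
have stateS t : optimal_state t.+1 = fun omega =>
    A *m optimal_state t omega + Bu *m u t omega + Bw *m w t omega.
  by apply/funext => omega; rewrite /u preview_feedbackE.
have mu t : (forall s, (s <= t)%N -> measurable_fun setT (optimal_state s)) ->
    measurable_fun setT (u t).
  by move=> ms; apply: (measurableT_comp (mk t)); exact: measurable_information.
have ms t s : (s <= t)%N -> measurable_fun setT (optimal_state s).
  elim: t s => [|t IH] s; first by rewrite leqn0 => /eqP ->.
  rewrite leq_eqVlt ltnS => /orP[/eqP ->|]; last exact: IH.
  rewrite stateS; exact: (measurable_mxD (measurable_mxD
    (measurable_mulmx A (IH t (leqnn t))) (measurable_mulmx Bu (mu t IH)))
    (measurable_mulmx Bw (mw t))).
exists optimal_state, u; split => //.
- by move=> t omega; rewrite stateS.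
- by move=> t; apply: mu => s; exact: ms.
move=> t E B hE mB.
have mut : measurable_fun setT (u t) by apply: mu => s; exact: ms.
have mus s : measurable_fun setT (u s) by apply: mu => r; exact: ms.
have mE : measurable E.
  apply: smallest_sub hE; first exact: sigma_algebra_measurable.
  rewrite !subUset; split; first split.
  - exact: sigma_of_measurable.
  - by apply: bigcup_sub => s _; exact: sigma_of_measurable.
  - by apply: bigcup_sub => s _; exact: sigma_of_measurable.
have muB : measurable (u t @^-1` B) by rewrite -[_ @^-1` _]setTI; exact: mut.
(* For a Dirac kernel the integrand is the indicator of [u t] lying in [B], so its integral over [E]
   is the measure of the intersection. *)
rewrite setIC -integral_indic//; apply: eq_integral => omega _.
Qed.

End optimality.

Theorem theorem3 (R : realType) (d : measure_display) (Omega : measurableType d)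
  (Pr : probability Omega R) (nx nu nw p : nat)
  (A : 'M[R]_nx) (Bu : 'M[R]_(nx, nu)) (Bw : 'M[R]_(nx, nw))
  (Q : 'M[R]_nx) (Ru : 'M[R]_nu) (P : 'M[R]_nx)
  (x0 : Omega -> 'cV[R]_nx) (w : nat -> Omega -> 'cV[R]_nw)
  (A_nonsingular : A \in unitmx) (AB_stabilizable : stabilizable A Bu)
  (Q_psd : psd Q) (R_pd : pd Ru) (AQ_detectable : detectable A Q)
  (x0_initial : initial_state Pr x0) (w_iid : iid_noise Pr x0 w)
  (P_stabilizing : stabilizing_solution A Bu Q Ru P) :
  exists mk : forall t : nat,
      measurable_fun setT (@preview_feedback R nx nu nw A Bu Bw Ru P p t),
    optimal Pr A Bu Bw Q Ru x0 w (fun t : nat => kdirac (mk t)).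
Proof.
have mk t := @measurable_preview_feedback R nx nu nw A Bu Bw Ru P p t.
exists mk; split; first exact: preview_feedback_loop.
move=> x u loop.
(* Optimality concerns every trajectory generated by the policy, not only the one just constructed,
   so the input has to be recovered from its law. *)
have u_opt : {ae Pr, forall omega, forall t, u t omega =
    optimal_input A Bu Ru P (x t omega) (Bw *m w t omega)
      (preview_sum A Bu Ru P Bw p (w ^~ omega) t.+1)}.
  have := kdirac_input_eq x0_initial w_iid loop.
  by apply: filterS => omega uE t; rewrite uE preview_feedbackE.
have x_stable := optimal_stabilizing x0_initial w_iid P_stabilizing loop u_opt.
have [c forcing_c] := forcing_cesaro p A Bu Bw Ru P x0_initial w_iid.
have cost_c := optimal_cost_limit x0_initial w_iid P_stabilizing loop u_opt forcing_c.
split=> //.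
  by apply: filterS cost_c => omega cost_c; apply/cvg_ex; exists c.
have mZ : measurable_fun setT (initial_information p x0 w).
  apply: (@measurable_information _ _ _ Pr nx nw p x0 w w_iid (fun=> x0) 0%N) => s _.
  by case: x0_initial.
(* The optimal cost does not depend on the initial information: the boundary term at time 0 is
   divided by [T]. *)
exists (fun=> c%:E); split; last first.
  move=> K' x' u' V' loop' x_stable' V'_cond.
  have mx' := loop_state_measurable x0_initial w_iid loop'.
  have mu' := loop_input_measurableT loop'.
  apply: cond_expectation_ge mZ (measurable_cost_infty Q Ru mx' mu') _ _ V'_cond.
    by move=> omega; exact: cost_infty_ge0.
  exact: (cost_lower_bound x0_initial w_iid P_stabilizing loop' x_stable' forcing_c).
split; first exact: measurable_cst.
have mx := loop_state_measurable x0_initial w_iid loop.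
have mu := loop_input_measurableT loop.
move=> B mB; apply: ae_eq_integral.
- by rewrite -[_ @^-1` _]setTI; exact: mZ.
- by apply: measurable_funTS; exact: measurable_cost_infty.
- exact: measurable_cst.
apply: filterS cost_c => omega cost_c _.
have cost_cE : (fun T => (average_cost Q Ru x u T omega)%:E) @ \oo --> c%:E.
  by apply: cvg_EFin => //; exact: nearW.
by rewrite /cost_infty (cvg_limn_einf_sup cost_cE).2.
Qed.
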